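(* Let $\mathcal{C}$ and $\mathcal{D}$ be rigidly-compactly generated tensor-triangulated categories and let $f^*:\mathcal{D}\to\mathcal{C}$ be a tensor-exact functor preserving arbitrary coproducts, with adjoints $f^*\dashv f_*\dashv f^{(1)}$ and $\omega_f:=f^{(1)}(\mathbf{1}_{\mathcal{D}})$. Let $\underline{\mathcal{C}}$ denote the $\mathcal{D}$-enriched category with the objects of $\mathcal{C}$ and Hom-objects $\underline{\mathcal{C}}(x,y):=f_*\,\mathsf{hom}_{\mathcal{C}}(x,y)\in\mathcal{D}$. Then there is a canonical natural isomorphism in $\mathcal{D}$ $$\sigma_{x,y}:\Delta\,\underline{\mathcal{C}}(x,y)\xrightarrow{\ \sim\ }\underline{\mathcal{C}}(y,x\otimes\omega_f)$$ for all $x\in\mathcal{C}^c$ and $y\in\mathcal{C}$, where $\Delta:=\mathsf{hom}_{\mathcal{D}}(-,\mathbf{1})$. In particular, if we have the Wirthm\''uller isomorphism for $f^*$, then the pair $(\mathbb{S}:=(-)\otimes\omega_f,\ \sigma)$ defines a Serre functor on $\mathcal{C}^c$ relative to $\mathcal{D}^c$, by which is meant that $\mathbb{S}$ is an equivalence $\mathbb{S}:\mathcal{C}^c\xrightarrow{\sim}\mathcal{C}^c$ and that $\sigma$ is a natural isomorphism $\Delta\,\underline{\mathcal{C}}(x,y)\cong\underline{\mathcal{C}}(y,\mathbb{S}x)$ in the tensor-category $\mathcal{D}^c$ for all $x,y\in\mathcal{C}^c$.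
   Context: A tensor-triangulated category is a triangulated category with a compatible closed symmetric monoidal structure, with tensor $\otimes$, unit $\mathbf{1}$, internal hom $\mathsf{hom}$; $\mathcal{C}^c$ denotes the subcategory of compact objects. An object $x$ is rigid if $\mathsf{hom}(x,\mathbf{1})\otimes y\to\mathsf{hom}(x,y)$ is an isomorphism for all $y$. The category is rigidly-compactly generated if it has arbitrary coproducts, is generated by a set of compact objects, and compact objects coincide with rigid objects. Tensor-exact means strong symmetric monoidal and triangulated. Under these hypotheses $f^*$ has a right adjoint $f_*$, which has a right adjoint $f^{(1)}$. The enrichment's unit and composition morphisms are obtained by adjunction from the $\mathcal{C}$-internal ones. ''We have the Wirthm\''uller isomorphism'' means: $f^*$ satisfies Grothendieck-Neeman duality (i.e. $f_*$ preserves compact objects, equivalently there are five adjoints $f_{(1)}\dashv f^*\dashv f_*\dashv f^{(1)}\dashv f_{(-1)}$) and moreover the following equivalent conditions hold: $\omega_f$ is compact; $\omega_f$ is $\otimes$-invertible; there is a $\otimes$-invertible $\omega$ with $f_{(1)}\cong f_*(\omega\otimes-)$; there is an infinite tower of adjoints on both sides of $f^*$. *)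

(* Defs.v *)
From mathcomp Require Import all_boot all_order all_algebra.
From mathcomp Require Import boolp classical_sets functions cardinality fsbigop.

Set Implicit Arguments.
Unset Strict Implicit.
Unset Printing Implicit Defensive.

Import GRing.Theory.
Local Open Scope ring_scope.

Declare Scope cat_scope.
Delimit Scope cat_scope with cat.
Open Scope cat_scope.

#[local] Obligation Tactic := idtac.

(* Small sets are the carriers of choiceTypes: Hom groups are zmodTypes and
   coproducts are indexed by choiceTypes.  The collection of objects is an
   arbitrary Type. *)
Record preadditive := Preadditive {
  ob :> Type;
  Hom : ob -> ob -> zmodType;
  idm : forall x, Hom x x;
  comp : forall x y z, Hom y z -> Hom x y -> Hom x z;
  compA : forall x y z t (h : Hom z t) (g : Hom y z) (f : Hom x y),
    comp h (comp g f) = comp (comp h g) f;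
  comp1m : forall x y (f : Hom x y), comp (idm y) f = f;
  compm1 : forall x y (f : Hom x y), comp f (idm x) = f;
  compDl : forall x y z (g g' : Hom y z) (f : Hom x y),
    comp (g + g') f = comp g f + comp g' f;
  compDr : forall x y z (g : Hom y z) (f f' : Hom x y),
    comp g (f + f') = comp g f + comp g f'
}.

Arguments Hom {_} x y.
Arguments idm {_} x.
Arguments comp {_ x y z} g f.
Notation "x ~> y" := (Hom x y) (at level 90, no associativity) : cat_scope.
Notation "g ∘ f" := (comp g f) (at level 40, left associativity) : cat_scope.

Section Basics.
Variable C : preadditive.
Implicit Types x y z : C.

Record iso x y := Iso {
  fwd :> x ~> y;
  inv : y ~> x;
  isoK : inv ∘ fwd = idm x;
  isoVK : fwd ∘ inv = idm y
}.

Definition isomorphic x y : Prop := inhabited (iso x y).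

Definition is_iso x y (f : x ~> y) : Prop :=
  exists g : y ~> x, g ∘ f = idm x /\ f ∘ g = idm y.

Definition is_zero x : Prop := idm x = 0.

Definition is_additive_category : Prop :=
  (exists z : C, is_zero z) /\
  (forall x y, exists (s : C) (i : x ~> s) (j : y ~> s) (p : s ~> x) (q : s ~> y),
    [/\ p ∘ i = idm x, q ∘ j = idm y & i ∘ p + j ∘ q = idm s]).

Definition is_coproduct (I : choiceType) (X : I -> C) (c : C)
    (inj : forall i, X i ~> c) : Prop :=
  forall (z : C) (g : forall i, X i ~> z),
    exists! h : c ~> z, forall i, h ∘ inj i = g i.

Definition has_coproducts : Prop :=
  forall (I : choiceType) (X : I -> C),
    exists (c : C) (inj : forall i, X i ~> c), is_coproduct inj.

(* The canonical map from the direct sum of the Hom x (X i), i.e. from the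
   finitely supported families, to Hom x (coproduct of the X i) is bijective. *)
Definition compact x : Prop :=
  forall (I : choiceType) (X : I -> C) (c : C) (inj : forall i, X i ~> c),
    is_coproduct inj ->
    forall h : x ~> c, exists! g : forall i, x ~> X i,
      finite_set [set i | g i != 0]%classic /\
      h = \sum_(i \in [set: I]%classic) (inj i ∘ g i).

(* The full subcategory on the objects satisfying P. *)
Definition full_sub (P : C -> Prop) : preadditive :=
  @Preadditive {x : C | P x}
    (fun a b => sval a ~> sval b)
    (fun a => idm (sval a)) (fun a b c g f => g ∘ f)
    (fun a b c d h g f => compA h g f)
    (fun a b f => comp1m f) (fun a b f => compm1 f)
    (fun a b c g g' f => compDl g g' f) (fun a b c g f f' => compDr g f f').

Definition compact_sub : preadditive := full_sub compact.

End Basics.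

Record functor (A B : preadditive) := Functor {
  fob :> A -> B;
  fmap : forall x y : A, (x ~> y) -> (fob x ~> fob y);
  fmap1 : forall x, fmap (idm x) = idm (fob x);
  fmapM : forall x y z (g : y ~> z) (f : x ~> y),
    fmap (g ∘ f) = fmap g ∘ fmap f
}.
Arguments fmap {A B} F {x y} f : rename.

Definition id_functor (A : preadditive) : functor A A :=
  @Functor A A id (fun x y f => f) (fun x => erefl) (fun x y z g f => erefl).

Program Definition comp_functor (A B E : preadditive)
    (G : functor B E) (F : functor A B) : functor A E :=
  @Functor A E (fun x => G (F x)) (fun x y f => fmap G (fmap F f)) _ _.
Next Obligation. by move=> A B E G F x /=; rewrite !fmap1. Qed.
Next Obligation. by move=> A B E G F x y z g f /=; rewrite !fmapM. Qed.

Section Functors.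
Variables A B : preadditive.
Implicit Types F : functor A B.

Definition additive_functor F : Prop :=
  forall (x y : A) (f g : x ~> y), fmap F (f + g) = fmap F f + fmap F g.

Definition preserves_coproducts F : Prop :=
  forall (I : choiceType) (X : I -> A) (c : A) (inj : forall i, X i ~> c),
    is_coproduct inj -> is_coproduct (fun i => fmap F (inj i)).

Definition preserves_compacts F : Prop :=
  forall x : A, compact x -> compact (F x).

Record nat_iso F F' := NatIso {
  nat_at :> forall x, iso (F x) (F' x);
  nat_isoE : forall x y (f : x ~> y), nat_at y ∘ fmap F f = fmap F' f ∘ nat_at x
}.

Definition restrict_functor (P : A -> Prop) (Q : B -> Prop) F
    (H : forall x, P x -> Q (F x)) : functor (full_sub P) (full_sub Q) :=
  @Functor (full_sub P) (full_sub Q)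
    (fun x => exist Q (F (sval x)) (H _ (svalP x)))
    (fun x y f => fmap F f)
    (fun x => fmap1 F (sval x)) (fun x y z g f => fmapM F g f).

(* F is left adjoint to G *)
Record adjunction F (G : functor B A) := Adjunction {
  adj_unit : forall x : A, x ~> G (F x);
  adj_counit : forall y : B, F (G y) ~> y;
  adj_unitE : forall (x x' : A) (f : x ~> x'),
    adj_unit x' ∘ f = fmap G (fmap F f) ∘ adj_unit x;
  adj_counitE : forall (y y' : B) (g : y ~> y'),
    g ∘ adj_counit y = adj_counit y' ∘ fmap F (fmap G g);
  adj_tri1 : forall x : A, adj_counit (F x) ∘ fmap F (adj_unit x) = idm (F x);
  adj_tri2 : forall y : B, fmap G (adj_counit y) ∘ adj_unit (G y) = idm (G y)
}.

End Functors.

Definition is_equivalence (A B : preadditive) (F : functor A B) : Prop :=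
  exists G : functor B A,
    inhabited (nat_iso (comp_functor G F) (id_functor A)) /\
    inhabited (nat_iso (comp_functor F G) (id_functor B)).

(** * Triangulated categories *)

Record triangulation (C : preadditive) := Triangulation {
  tri_additive : is_additive_category C;
  shift : functor C C;
  unshift : functor C C;
  shift_add : additive_functor shift;
  shiftK : nat_iso (comp_functor unshift shift) (id_functor C);
  unshiftK : nat_iso (comp_functor shift unshift) (id_functor C);
  dist : forall x y z : C, (x ~> y) -> (y ~> z) -> (z ~> shift x) -> Prop;
  dist_iso : forall (x y z x' y' z' : C)
      (f : x ~> y) (g : y ~> z) (h : z ~> shift x)
      (f' : x' ~> y') (g' : y' ~> z') (h' : z' ~> shift x')
      (u : iso x x') (v : iso y y') (w : iso z z'),
    v ∘ f = f' ∘ u -> w ∘ g = g' ∘ v -> fmap shift u ∘ h = h' ∘ w ->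
    dist f g h -> dist f' g' h';
  dist_id : forall x z : C, is_zero z ->
    dist (idm x) (0 : x ~> z) (0 : z ~> shift x);
  dist_cone : forall (x y : C) (f : x ~> y),
    exists (z : C) (g : y ~> z) (h : z ~> shift x), dist f g h;
  dist_rotate : forall (x y z : C) (f : x ~> y) (g : y ~> z) (h : z ~> shift x),
    dist f g h <-> dist g h (- fmap shift f);
  dist_fill : forall (x y z x' y' z' : C)
      (f : x ~> y) (g : y ~> z) (h : z ~> shift x)
      (f' : x' ~> y') (g' : y' ~> z') (h' : z' ~> shift x')
      (u : x ~> x') (v : y ~> y'),
    dist f g h -> dist f' g' h' -> v ∘ f = f' ∘ u ->
    exists w : z ~> z', w ∘ g = g' ∘ v /\ fmap shift u ∘ h = h' ∘ w;
  dist_octahedron : forall (x y z a b c : C) (f : x ~> y) (g : y ~> z)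
      (i1 : y ~> a) (j1 : a ~> shift x)
      (i2 : z ~> b) (j2 : b ~> shift x)
      (i3 : z ~> c) (j3 : c ~> shift y),
    dist f i1 j1 -> dist (g ∘ f) i2 j2 -> dist g i3 j3 ->
    exists (u : a ~> b) (v : b ~> c),
      [/\ dist u v (fmap shift i1 ∘ j3),
          u ∘ i1 = i2 ∘ g, j2 ∘ u = j1,
          v ∘ i2 = i3 & j3 ∘ v = fmap shift f ∘ j2]
}.

(** * Closed symmetric monoidal categories *)

Record closed_smc := ClosedSMC {
  smc_cat :> preadditive;
  tens : smc_cat -> smc_cat -> smc_cat;
  tensm : forall x x' y y' : smc_cat,
    (x ~> x') -> (y ~> y') -> (tens x y ~> tens x' y');
  tensm1 : forall x y, tensm (idm x) (idm y) = idm (tens x y);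
  tensmM : forall x x' x'' y y' y'' (f' : x' ~> x'') (f : x ~> x')
      (g' : y' ~> y'') (g : y ~> y'),
    tensm (f' ∘ f) (g' ∘ g) = tensm f' g' ∘ tensm f g;
  tunit : smc_cat;
  assoc : forall x y z, iso (tens (tens x y) z) (tens x (tens y z));
  lunit : forall x, iso (tens tunit x) x;
  runit : forall x, iso (tens x tunit) x;
  braid : forall x y, tens x y ~> tens y x;
  assocE : forall x x' y y' z z' (f : x ~> x') (g : y ~> y') (h : z ~> z'),
    assoc x' y' z' ∘ tensm (tensm f g) h = tensm f (tensm g h) ∘ assoc x y z;
  lunitE : forall x x' (f : x ~> x'),
    lunit x' ∘ tensm (idm tunit) f = f ∘ lunit x;
  runitE : forall x x' (f : x ~> x'),
    runit x' ∘ tensm f (idm tunit) = f ∘ runit x;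
  braidE : forall x x' y y' (f : x ~> x') (g : y ~> y'),
    braid x' y' ∘ tensm f g = tensm g f ∘ braid x y;
  braidK : forall x y, braid y x ∘ braid x y = idm (tens x y);
  pentagon : forall x y z t,
    assoc x y (tens z t) ∘ assoc (tens x y) z t =
    tensm (idm x) (assoc y z t) ∘ assoc x (tens y z) t ∘
      tensm (assoc x y z) (idm t);
  triangle : forall x y,
    tensm (idm x) (lunit y) ∘ assoc x tunit y = tensm (runit x) (idm y);
  hexagon : forall x y z,
    assoc y z x ∘ braid x (tens y z) ∘ assoc x y z =
    tensm (idm y) (braid x z) ∘ assoc y x z ∘ tensm (braid x y) (idm z);
  ihom : smc_cat -> smc_cat -> smc_cat;
  ev : forall x y, tens (ihom x y) x ~> y;
  curry : forall x y z, (tens x y ~> z) -> (x ~> ihom y z);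
  curryK : forall x y z (f : tens x y ~> z),
    ev y z ∘ tensm (curry f) (idm y) = f;
  uncurryK : forall x y z (g : x ~> ihom y z),
    curry (ev y z ∘ tensm g (idm y)) = g
}.

Arguments tens {_} x y.
Arguments tensm {_ x x' y y'} f g.
Arguments tunit {_}.
Arguments assoc {_} x y z.
Arguments lunit {_} x.
Arguments runit {_} x.
Arguments braid {_} x y.
Arguments ihom {_} x y.
Arguments ev {_} x y.
Arguments curry {_ x y z} f.
Notation "x ⊗ y" := (tens x y) (at level 35, right associativity) : cat_scope.
Notation "f ⊗m g" := (tensm f g) (at level 35, right associativity) : cat_scope.

Section Closed.
Variable C : closed_smc.
Implicit Types x y z w : C.

Definition ihomm x x' y y' (u : x' ~> x) (v : y ~> y') :
    ihom x y ~> ihom x' y' :=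
  curry (v ∘ ev x y ∘ (idm (ihom x y) ⊗m u)).

Definition dual x : C := ihom x tunit.
Definition dualm x x' (u : x' ~> x) : dual x ~> dual x' := ihomm u (idm tunit).

Lemma tensm_idr_comp x y z w (g : y ~> z) (f : x ~> y) :
  ((g ∘ f) ⊗m idm w) = (g ⊗m idm w) ∘ (f ⊗m idm w).
Proof. by rewrite -tensmM comp1m. Qed.

Lemma tensm_idl_comp x y z w (g : y ~> z) (f : x ~> y) :
  (idm w ⊗m (g ∘ f)) = (idm w ⊗m g) ∘ (idm w ⊗m f).
Proof. by rewrite -tensmM comp1m. Qed.

Program Definition tensor_right w : functor C C :=
  @Functor C C (fun x => x ⊗ w) (fun x y f => f ⊗m idm w) _ _.
Next Obligation. by move=> w x /=; rewrite tensm1. Qed.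
Next Obligation. by move=> w x y z g f /=; rewrite tensm_idr_comp. Qed.

Program Definition tensor_left w : functor C C :=
  @Functor C C (fun x => w ⊗ x) (fun x y f => idm w ⊗m f) _ _.
Next Obligation. by move=> w x /=; rewrite tensm1. Qed.
Next Obligation. by move=> w x y z g f /=; rewrite tensm_idl_comp. Qed.

Definition tensor_invertible x : Prop := exists y, isomorphic (x ⊗ y) tunit.

Definition dual_tens_to_ihom x y : dual x ⊗ y ~> ihom x y :=
  curry (lunit y ∘ (ev x tunit ⊗m idm y) ∘ inv (assoc (dual x) x y)
           ∘ (idm (dual x) ⊗m braid y x) ∘ assoc (dual x) y x).

Definition rigid x : Prop := forall y, is_iso (dual_tens_to_ihom x y).

Definition ihom_tens_to_ihom2 x y w : ihom (x ⊗ y) w ~> ihom y (ihom x w) :=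
  curry (curry (ev (x ⊗ y) w ∘ (idm (ihom (x ⊗ y) w) ⊗m braid y x)
                  ∘ assoc (ihom (x ⊗ y) w) y x)).

Definition tens_to_ihom_dual x w : x ⊗ w ~> ihom (dual x) w :=
  curry (runit w ∘ (idm w ⊗m (ev x tunit ∘ braid x (dual x)))
           ∘ assoc w x (dual x) ∘ (braid x w ⊗m idm (dual x))).

Definition icomp x y z : ihom y z ⊗ ihom x y ~> ihom x z :=
  curry (ev y z ∘ (idm (ihom y z) ⊗m ev x y) ∘ assoc (ihom y z) (ihom x y) x).
Definition iid x : tunit ~> ihom x x := curry (lunit x).

Lemma ihom_ext x y z (f g : x ~> ihom y z) :
  ev y z ∘ (f ⊗m idm y) = ev y z ∘ (g ⊗m idm y) -> f = g.
Proof. by move=> e; rewrite -(uncurryK f) e uncurryK. Qed.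

Lemma tensm_swap x x' y y' (f : x ~> x') (g : y ~> y') :
  (f ⊗m idm y') ∘ (idm x ⊗m g) = (idm x' ⊗m g) ∘ (f ⊗m idm y).
Proof. by rewrite -!tensmM !comp1m !compm1. Qed.

Lemma tens_unit_inj x y (f g : x ~> y) :
  (idm tunit ⊗m f) = (idm tunit ⊗m g) -> f = g.
Proof.
move=> e; rewrite -(compm1 f) -(compm1 g) -(isoVK (lunit x)) !compA.
by rewrite -!lunitE e.
Qed.

Lemma lunit_tens x y : lunit (x ⊗ y) ∘ assoc tunit x y = lunit x ⊗m idm y.
Proof.
apply: tens_unit_inj; rewrite tensm_idl_comp.
pose a : iso _ _ := assoc tunit (tunit ⊗ x) y.
pose b := assoc tunit tunit x ⊗m idm y.
pose b' := inv (assoc tunit tunit x) ⊗m idm y.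
have bb' : b ∘ b' = idm _ by rewrite -tensm_idr_comp isoVK tensm1.
suff : (idm tunit ⊗m lunit (x ⊗ y)) ∘ (idm tunit ⊗m assoc tunit x y) ∘ a ∘ b =
       (idm tunit ⊗m (lunit x ⊗m idm y)) ∘ a ∘ b.
  move=> /(congr1 (fun h => h ∘ b' ∘ inv a)).
  by rewrite -!compA (compA b) bb' comp1m isoVK !compm1.
rewrite -!compA (compA (idm tunit ⊗m assoc _ _ _)) -pentagon.
rewrite !compA triangle -[in RHS]assocE -(tensm1 x y) -assocE.
by rewrite -compA /b -tensm_idr_comp triangle.
Qed.

Lemma icompA x y z w :
  icomp x z w ∘ (idm _ ⊗m icomp x y z) ∘ assoc (ihom z w) (ihom y z) (ihom x y)
  = icomp x y w ∘ (icomp y z w ⊗m idm _).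
Proof.
apply: ihom_ext; rewrite !tensm_idr_comp !compA !curryK.
rewrite -(compA _ (assoc _ _ _)) assocE compA -(compA _ _ (_ ⊗m (_ ⊗m _))).
rewrite -tensm_idl_comp curryK !tensm_idl_comp.
rewrite -(compA _ (assoc (ihom y w) _ _)) assocE tensm1 !compA.
rewrite -(compA (ev y w)) -tensm_swap compA curryK.
rewrite -[LHS]compA -[LHS]compA (compA (_ ⊗m assoc _ _ _)) -pentagon.
rewrite -!compA; congr (_ ∘ (_ ∘ _)).
by rewrite !compA -(tensm1 (ihom z w)) assocE.
Qed.

Lemma icomp1l x y : icomp x y y ∘ (iid y ⊗m idm _) = lunit (ihom x y).
Proof.
apply: ihom_ext; rewrite tensm_idr_comp compA curryK.
rewrite -compA assocE tensm1 compA -(compA (ev y y)) -tensm_swap compA curryK.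
by rewrite lunitE -compA lunit_tens.
Qed.

Lemma icomp1r x y : icomp x x y ∘ (idm _ ⊗m iid x) = runit (ihom x y).
Proof.
apply: ihom_ext; rewrite tensm_idr_comp compA curryK.
by rewrite -compA assocE compA -(compA (ev x y)) -tensm_idl_comp curryK -compA triangle.
Qed.

End Closed.

(** * Enriched categories *)

Record enriched_category (V : closed_smc) := EnrichedCategory {
  eob :> Type;
  ehom : eob -> eob -> V;
  eid : forall x, tunit ~> ehom x x;
  ecomp : forall x y z, ehom y z ⊗ ehom x y ~> ehom x z;
  ecompA : forall x y z w,
    ecomp x z w ∘ (idm (ehom z w) ⊗m ecomp x y z)
      ∘ assoc (ehom z w) (ehom y z) (ehom x y)
    = ecomp x y w ∘ (ecomp y z w ⊗m idm (ehom x y));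
  ecomp1l : forall x y,
    ecomp x y y ∘ (eid y ⊗m idm (ehom x y)) = lunit (ehom x y);
  ecomp1r : forall x y,
    ecomp x x y ∘ (idm (ehom x y) ⊗m eid x) = runit (ehom x y)
}.

(** * Tensor-triangulated categories *)

(* Compatibility in the sense of Hovey-Palmieri-Strickland,
   Axiomatic stable homotopy theory, Definition A.2.1. *)
Record tt_category := TTCategory {
  tt_smc :> closed_smc;
  tt_tri : triangulation tt_smc;
  sh := shift tt_tri;
  tens_shift : forall x y : tt_smc, iso (sh x ⊗ y) (sh (x ⊗ y));
  tens_shiftE : forall (x x' y y' : tt_smc) (f : x ~> x') (g : y ~> y'),
    tens_shift x' y' ∘ (fmap sh f ⊗m g) = fmap sh (f ⊗m g) ∘ tens_shift x y;
  tens_shift_unit : forall x : tt_smc,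
    fmap sh (runit x) ∘ tens_shift x tunit = runit (sh x);
  tens_shift_assoc : forall x y z : tt_smc,
    tens_shift x (y ⊗ z) ∘ assoc (sh x) y z =
    fmap sh (assoc x y z) ∘ tens_shift (x ⊗ y) z ∘ (tens_shift x y ⊗m idm z);
  tens_exact : forall (w x y z : tt_smc)
      (f : x ~> y) (g : y ~> z) (h : z ~> sh x),
    dist (t := tt_tri) f g h ->
    dist (t := tt_tri) (f ⊗m idm w) (g ⊗m idm w) (tens_shift x w ∘ (h ⊗m idm w));
  (* the connecting map is ihom w h followed by ihom w (sh x) = sh (ihom w x),
     the (invertible) transpose of tens_shift *)
  ihom_exact : forall (w x y z : tt_smc)
      (f : x ~> y) (g : y ~> z) (h : z ~> sh x) (k : ihom w z ~> sh (ihom w x)),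
    dist (t := tt_tri) f g h ->
    curry (fmap sh (ev w x) ∘ tens_shift (ihom w x) w) ∘ k = ihomm (idm w) h ->
    dist (t := tt_tri) (ihomm (idm w) f) (ihomm (idm w) g) k;
  (* The triangle obtained from
       sh^-1 (ihom x w) --(- ihom h w)--> ihom z w -> ihom y w -> ihom x w
     by one rotation; the connecting map is ihom x w = sh (ihom (sh x) w)
     followed by sh (ihom h w). *)
  ihom_coexact : forall (w x y z : tt_smc)
      (f : x ~> y) (g : y ~> z) (h : z ~> sh x) (k : ihom x w ~> sh (ihom z w)),
    dist (t := tt_tri) f g h ->
    k ∘ curry (ev (sh x) w ∘ braid (sh x) (ihom (sh x) w)
                 ∘ inv (tens_shift x (ihom (sh x) w))
                 ∘ fmap sh (braid (ihom (sh x) w) x)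
                 ∘ tens_shift (ihom (sh x) w) x)
      = fmap sh (ihomm h (idm w)) ->
    dist (t := tt_tri) (ihomm g (idm w)) (ihomm f (idm w)) k;
  braid_shift_unit :
    braid (sh tunit) (sh tunit) = - idm (sh tunit ⊗ sh tunit) :> (_ ~> _)
}.

Definition generates (C : tt_category) (I : choiceType) (G : I -> C) : Prop :=
  forall x : C,
    (forall (i : I) (n : nat),
       (forall f : iter n (shift (tt_tri C)) (G i) ~> x, f = 0) /\
       (forall f : iter n (unshift (tt_tri C)) (G i) ~> x, f = 0)) ->
    is_zero x.

Record rigidly_compactly_generated (C : tt_category) : Prop := {
  rcg_coproducts : has_coproducts C;
  rcg_generated : exists (I : choiceType) (G : I -> C),
    (forall i, compact (G i)) /\ generates G;
  rcg_compact_rigid : forall x : C, compact x <-> rigid x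
}.

(** * Tensor-exact functors *)

Record strong_monoidal (A B : closed_smc) (F : functor A B) := StrongMonoidal {
  mon_tens : forall x y : A, iso (F x ⊗ F y) (F (x ⊗ y));
  mon_unit : iso tunit (F tunit);
  mon_tensE : forall (x x' y y' : A) (f : x ~> x') (g : y ~> y'),
    mon_tens x' y' ∘ (fmap F f ⊗m fmap F g) = fmap F (f ⊗m g) ∘ mon_tens x y;
  mon_assoc : forall x y z : A,
    fmap F (assoc x y z) ∘ mon_tens (x ⊗ y) z ∘ (mon_tens x y ⊗m idm (F z)) =
    mon_tens x (y ⊗ z) ∘ (idm (F x) ⊗m mon_tens y z) ∘ assoc (F x) (F y) (F z);
  mon_lunit : forall x : A,
    fmap F (lunit x) ∘ mon_tens tunit x ∘ (mon_unit ⊗m idm (F x)) = lunit (F x);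
  mon_runit : forall x : A,
    fmap F (runit x) ∘ mon_tens x tunit ∘ (idm (F x) ⊗m mon_unit) = runit (F x);
  mon_braid : forall x y : A,
    fmap F (braid x y) ∘ mon_tens x y = mon_tens y x ∘ braid (F x) (F y)
}.

Record exact_functor (A B : tt_category) (F : functor A B) := ExactFunctor {
  ex_additive : additive_functor F;
  ex_shift : nat_iso (comp_functor F (shift (tt_tri A)))
                     (comp_functor (shift (tt_tri B)) F);
  ex_dist : forall (x y z : A)
      (f : x ~> y) (g : y ~> z) (h : z ~> shift (tt_tri A) x),
    dist (t := tt_tri A) f g h ->
    dist (t := tt_tri B) (fmap F f) (fmap F g) (ex_shift x ∘ fmap F h)
}.

Record tensor_exact_functor (A B : tt_category) := TensorExactFunctor {
  te_functor :> functor A B;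
  te_monoidal : strong_monoidal te_functor;
  te_exact : exact_functor te_functor
}.

(** * The lax monoidal right adjoint, and the enrichment of C over D *)

Section Enrichment.
Variables (D C : closed_smc) (F : functor D C) (mF : strong_monoidal F).
Variables (G : functor C D) (adj : adjunction F G).

Definition lax_tens (a b : C) : G a ⊗ G b ~> G (a ⊗ b) :=
  fmap G ((adj_counit adj a ⊗m adj_counit adj b)
            ∘ inv (mon_tens mF (G a) (G b)))
    ∘ adj_unit adj (G a ⊗ G b).

Definition lax_unit : tunit ~> G tunit :=
  fmap G (inv (mon_unit mF)) ∘ adj_unit adj tunit.

Lemma adj_ext (x : D) (y : C) (f g : x ~> G y) :
  adj_counit adj y ∘ fmap F f = adj_counit adj y ∘ fmap F g -> f = g.
Proof.
have K h : fmap G (adj_counit adj y ∘ fmap F h) ∘ adj_unit adj x = h.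
  by rewrite fmapM -compA -adj_unitE compA adj_tri2 comp1m.
by move=> e; rewrite -(K f) e K.
Qed.

Lemma adj_transpose (x : D) (y : C) (h : F x ~> y) :
  adj_counit adj y ∘ fmap F (fmap G h ∘ adj_unit adj x) = h.
Proof. by rewrite fmapM compA -adj_counitE -compA adj_tri1 compm1. Qed.

Lemma lax_tensK a b : adj_counit adj (a ⊗ b) ∘ fmap F (lax_tens a b) =
  (adj_counit adj a ⊗m adj_counit adj b) ∘ inv (mon_tens mF (G a) (G b)).
Proof. exact: adj_transpose. Qed.

Lemma lax_unitK :
  adj_counit adj tunit ∘ fmap F lax_unit = inv (mon_unit mF).
Proof. exact: adj_transpose. Qed.

Lemma mon_tensVE (x x' y y' : D) (f : x ~> x') (g : y ~> y') :
  inv (mon_tens mF x' y') ∘ fmap F (f ⊗m g) =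
  (fmap F f ⊗m fmap F g) ∘ inv (mon_tens mF x y).
Proof.
rewrite -[LHS]compm1 -(isoVK (mon_tens mF x y)) !compA.
by rewrite -(compA _ (fmap F _)) -mon_tensE compA isoK comp1m.
Qed.

Lemma lax_tensE (a a' b b' : C) (f : a ~> a') (g : b ~> b') :
  lax_tens a' b' ∘ (fmap G f ⊗m fmap G g) = fmap G (f ⊗m g) ∘ lax_tens a b.
Proof.
apply: adj_ext; rewrite [in LHS]fmapM [in RHS]fmapM !compA lax_tensK -adj_counitE.
rewrite -compA mon_tensVE -(compA (f ⊗m g)) lax_tensK !compA.
by rewrite -!tensmM !adj_counitE.
Qed.

Lemma mon_assocV (x y z : D) :
  assoc (F x) (F y) (F z) ∘ (inv (mon_tens mF x y) ⊗m idm (F z))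
    ∘ inv (mon_tens mF (x ⊗ y) z) =
  (idm (F x) ⊗m inv (mon_tens mF y z)) ∘ inv (mon_tens mF x (y ⊗ z))
    ∘ fmap F (assoc x y z).
Proof.
set p := mon_tens mF (x ⊗ y) z; set q := mon_tens mF x y.
set r := mon_tens mF x (y ⊗ z); set s := mon_tens mF y z.
have e := mon_assoc mF x y z; rewrite -/p -/q -/r -/s in e.
have e1 : fmap F (assoc x y z) =
    r ∘ (idm _ ⊗m s) ∘ assoc (F x) (F y) (F z) ∘ (inv q ⊗m idm _) ∘ inv p.
  rewrite -e -!compA (compA (q ⊗m _)) -tensm_idr_comp isoVK tensm1 comp1m.
  by rewrite isoVK compm1.
rewrite e1 !compA -(compA _ (inv r)) isoK compm1.
by rewrite -tensm_idl_comp isoK tensm1 comp1m.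
Qed.

Lemma lax_assoc (a b c : C) :
  fmap G (assoc a b c) ∘ lax_tens (a ⊗ b) c ∘ (lax_tens a b ⊗m idm (G c)) =
  lax_tens a (b ⊗ c) ∘ (idm (G a) ⊗m lax_tens b c) ∘ assoc (G a) (G b) (G c).
Proof.
apply: adj_ext; rewrite 2![in LHS]fmapM 2![in RHS]fmapM !compA lax_tensK -adj_counitE.
rewrite -(compA (assoc _ _ _)) lax_tensK -!compA mon_tensVE !fmap1.
rewrite (compA (inv _)) mon_tensVE fmap1 !compA -tensmM compm1 lax_tensK.
rewrite -(compA (assoc _ _ _)) -tensmM lax_tensK compm1.
rewrite -[X in _ ⊗m X]compm1 tensmM -(compm1 (adj_counit adj a)) tensmM.
rewrite !compm1 compA assocE -!compA; congr (_ ∘ _).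
by rewrite !compA mon_assocV.
Qed.

Lemma lax_lunit (a : C) :
  fmap G (lunit a) ∘ lax_tens tunit a ∘ (lax_unit ⊗m idm (G a)) = lunit (G a).
Proof.
apply: adj_ext; rewrite 2![in LHS]fmapM !compA -adj_counitE -(compA (lunit a)) lax_tensK.
rewrite -!compA mon_tensVE fmap1 (compA (_ ⊗m _)) -tensmM lax_unitK compm1.
rewrite -(comp1m (inv (mon_unit mF))) -(compm1 (adj_counit adj a)) tensmM.
rewrite !compA lunitE -(mon_lunit mF) compm1 -!compA; congr (_ ∘ _).
rewrite (compA (_ ⊗m _) (_ ⊗m _)) -tensm_idr_comp isoVK tensm1 comp1m.
by rewrite isoVK compm1.
Qed.

Lemma lax_runit (a : C) :
  fmap G (runit a) ∘ lax_tens a tunit ∘ (idm (G a) ⊗m lax_unit) = runit (G a).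
Proof.
apply: adj_ext; rewrite 2![in LHS]fmapM !compA -adj_counitE -(compA (runit a)) lax_tensK.
rewrite -!compA mon_tensVE fmap1 (compA (_ ⊗m _)) -tensmM lax_unitK compm1.
rewrite -(comp1m (inv (mon_unit mF))) -(compm1 (adj_counit adj a)) tensmM.
rewrite !compA runitE -(mon_runit mF) compm1 -!compA; congr (_ ∘ _).
rewrite (compA (_ ⊗m _) (_ ⊗m _)) -tensm_idl_comp isoVK tensm1 comp1m.
by rewrite isoVK compm1.
Qed.

Definition enrich_id (x : C) : tunit ~> G (ihom x x) :=
  fmap G (iid x) ∘ lax_unit.
Definition enrich_comp (x y z : C) :
    G (ihom y z) ⊗ G (ihom x y) ~> G (ihom x z) :=
  fmap G (icomp x y z) ∘ lax_tens (ihom y z) (ihom x y).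

Lemma enrich_compA (x y z w : C) :
  enrich_comp x z w ∘ (idm _ ⊗m enrich_comp x y z)
    ∘ assoc (G (ihom z w)) (G (ihom y z)) (G (ihom x y))
  = enrich_comp x y w ∘ (enrich_comp y z w ⊗m idm _).
Proof.
rewrite /enrich_comp; move: lax_tens lax_tensE lax_assoc => m mE mA.
rewrite tensm_idl_comp tensm_idr_comp -!(fmap1 G) !compA.
rewrite -[in LHS](compA _ _ (fmap G _ ⊗m fmap G _)).
rewrite mE compA -fmapM -[in RHS](compA _ _ (fmap G _ ⊗m fmap G _)) mE.
rewrite compA -fmapM -icompA 2![in RHS]fmapM !(fmap1 G).
by rewrite fmapM -!compA; congr (_ ∘ (_ ∘ _)); rewrite [RHS]compA mA compA.
Qed.

Lemma enrich_comp1l (x y : C) :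
  enrich_comp x y y ∘ (enrich_id y ⊗m idm _) = lunit (G (ihom x y)).
Proof.
rewrite /enrich_comp /enrich_id.
move: lax_tens lax_unit lax_tensE lax_lunit => m u mE mu.
rewrite tensm_idr_comp -{1}(fmap1 G) !compA -(compA _ (m _ _)) mE.
by rewrite !compA -fmapM icomp1l mu.
Qed.

Lemma enrich_comp1r (x y : C) :
  enrich_comp x x y ∘ (idm _ ⊗m enrich_id x) = runit (G (ihom x y)).
Proof.
rewrite /enrich_comp /enrich_id.
move: lax_tens lax_unit lax_tensE lax_runit => m u mE mu.
rewrite tensm_idl_comp -{1}(fmap1 G) !compA -(compA _ (m _ _)) mE.
by rewrite !compA -fmapM icomp1r mu.
Qed.

Definition enrichment : enriched_category D :=
  EnrichedCategory enrich_compA enrich_comp1l enrich_comp1r.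

Definition enrichm (x x' y y' : C) (u : x' ~> x) (v : y ~> y') :
    @ehom D enrichment x y ~> @ehom D enrichment x' y' :=
  fmap G (ihomm u v).

(* The internal form of an adjunction G -| H, as a comparison morphism. *)
Definition internal_adj (H : functor D C) (adj' : adjunction G H)
    (a : C) (d : D) : G (ihom a (H d)) ~> ihom (G a) d :=
  curry (adj_counit adj' d ∘ fmap G (ev a (H d)) ∘ lax_tens (ihom a (H d)) a).

End Enrichment.

(** * Serre functors relative to D *)

Section Serre.
Variables (D C : tt_category) (f : tensor_exact_functor D C).
Variables (fR : functor C D) (adj : adjunction f fR).
Variables (fRR : functor D C) (adj' : adjunction fR fRR).

Let mf := te_monoidal f.

(* uC is the D-enriched category with the objects of C and uHom x y, that is
   f_* hom(x,y), as Hom-objects; uHomm is the action of morphisms of C. *)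
Definition uC : enriched_category D := enrichment mf adj.
Definition uHom (x y : C) : D := @ehom D uC x y.
Definition uHomm (x x' y y' : C) (u : x' ~> x) (v : y ~> y') :
  uHom x y ~> uHom x' y' := enrichm mf adj u v.

Definition dualizing : C := fRR tunit.

(* The canonical s is the composite of the canonical isomorphisms
     hom(f_* hom(x,y), 1) <-- f_* hom(hom(x,y), w)
       --> f_* hom(hom(x,1) (x) y, w) --> f_* hom(y, hom(hom(x,1), w))
       <-- f_* hom(y, x (x) w),      w = dualizing object,
   the first being the internal form of the adjunction f_* -| f^(1); the arrows
   pointing to the left are invertible when x is compact, so that the equation
   below determines s. *)
Definition canonical_serre (x y : C)
    (s : dual (uHom x y) ~> uHom y (x ⊗ dualizing)) : Prop :=
  uHomm (idm y) (tens_to_ihom_dual x dualizing) ∘ s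
    ∘ internal_adj mf adj adj' (ihom x y) tunit
  = fmap fR (ihom_tens_to_ihom2 (dual x) y dualizing)
    ∘ fmap fR (ihomm (dual_tens_to_ihom x y) (idm dualizing)).

(* dual (uHom x y) is covariant in x and contravariant in y. *)
Definition serre_natural (S : functor C C)
    (s : forall (x : compact_sub C) (y : C),
       dual (uHom (sval x) y) ~> uHom y (S (sval x))) : Prop :=
  forall (x x' : compact_sub C) (u : x ~> x') (y y' : C) (v : y' ~> y),
    uHomm v (fmap S u) ∘ s x y = s x' y' ∘ dualm (uHomm u v).

Record relative_serre_functor (S : functor C C)
    (s : forall x y : compact_sub C,
       dual (uHom (sval x) (sval y)) ~> uHom (sval y) (S (sval x))) : Prop := {
  serre_equiv : exists H : forall x : C, compact x -> compact (S x),
    is_equivalence (restrict_functor H);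
  serre_hom_compact : forall x y : compact_sub C,
    compact (uHom (sval x) (sval y)) /\
    compact (dual (uHom (sval x) (sval y)));
  serre_iso : forall x y : compact_sub C, is_iso (s x y);
  serre_nat : forall (x x' y y' : compact_sub C) (u : x ~> x') (v : y' ~> y),
    uHomm v (fmap S u) ∘ s x y = s x' y' ∘ dualm (uHomm u v)
}.

Definition GN_duality : Prop := preserves_compacts fR.

(* ... -| G n -| F n -| G (n + 1) -| F (n + 1) -| ..., with F 0 = f *)
Definition infinite_tower : Prop :=
  exists (F : int -> functor D C) (G : int -> functor C D),
    F 0 = te_functor f /\
    forall n, inhabited (adjunction (G n) (F n)) /\
              inhabited (adjunction (F n) (G (n + 1))).

(* Under GN_duality the four conditions are equivalent, so that assuming
   their disjunction covers each way of having the isomorphism. *)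
Definition wirthmuller : Prop :=
  GN_duality /\
  [\/ compact dualizing,
      tensor_invertible dualizing,
      exists (w : C) (fL : functor C D),
        [/\ tensor_invertible w, inhabited (adjunction fL f) &
            inhabited (nat_iso fL (comp_functor fR (tensor_left w)))] |
      infinite_tower].

End Serre.

Arguments serre_natural {D C f fR} adj S s.
Arguments relative_serre_functor {D C f fR} adj S s.
Arguments canonical_serre {D C f fR} adj {fRR} adj' {x y} s.

(* Main.v *)
From mathcomp Require Import all_boot all_algebra.
From mathcomp Require Import boolp classical_sets functions cardinality fsbigop.
Require Import Defs.

Set Implicit Arguments.
Unset Strict Implicit.
Unset Printing Implicit Defensive.

Import GRing.Theory.
Local Open Scope ring_scope.

(** The isomorphism is built from three facts.

    (1) Internal adjunction: f_* hom(a, f^(1) d) -> hom(f_* a, d) is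
    invertible for all a and d.  Since the target category is generated by
    compact objects, it is enough that Hom(c, -) turns this map into a
    bijection for each compact c ([compact_detects_iso]).  By adjunction that
    bijection is composition with the projection morphism
    c (x) f_* a -> f_* (f^* c (x) a) ([internal_adj_transpose]).  As c is
    rigid, so is f^* c, and tensoring with c or f^* c is a right adjoint on
    both sides; the right adjoints of two isomorphic functors agree, which
    makes the projection morphism invertible ([projection_iso]).

    (2) Rigidity of x makes hom(x, 1) (x) y -> hom(x, y) invertible by
    definition, and provides a coevaluation; the two triangle identities
    ([rigid_dual_pair]) then show that x (x) w -> hom(hom(x, 1), w) is
    invertible as well ([rigid_tens_to_ihom_dual]).

    (3) Each constituent is natural.  Conjugating by the invertible ones gives
    sigma, and since the defining equation of sigma involves only invertible
    natural morphisms, sigma is natural too ([canonical_serre_natural]).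

    In the Wirthmueller case, everything reduces to the invertibility of
    w = f^(1) 1, because tensoring with an invertible object is an equivalence
    preserving compact objects ([tensor_equivalence]).

    - If w is compact and f_* preserves compact objects, then for compact x
      Hom(x, hom(w, w)) = Hom(f_*(x (x) w), 1), and f_*(x (x) w) is the dual of
      f_* hom(x, 1) by (1) and (2).  The latter object being rigid, these
      groups are Hom(1, f_* hom(x, 1)) = Hom(x, 1).  The Yoneda lemma among
      compact objects gives hom(w, w) = 1, that is, hom(w, 1) (x) w = 1.
    - If f_*(v (x) -) is left adjoint to f^* with v invertible, then
      Hom(x, hom(v, w)) = Hom(f_*(v (x) x), 1) = Hom(x, 1) for all x, so
      hom(v, 1) (x) w = 1.
    - In an infinite tower, f^(1) has a right adjoint which is itself a left
      adjoint and hence preserves coproducts; so f^(1) preserves compact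
      objects, w is compact, and the first case applies. *)

(** * Isomorphisms in preadditive categories *)

(** Matching is purely syntactic, so that unlike repeated rewriting with
    [compA] this never unfolds a definition whose body is a composite. *)
Ltac right_nest := repeat match goal with
  |- context [comp (comp ?h ?g) ?f] => rewrite -(compA h g f) end.

Section Cat.
Variable C : preadditive.
Implicit Types x y z : C.

(** [reassoc] and [reassoc2] turn an equation between composites into a
    rewrite rule that applies at the head of a longer right-nested composite. *)
Lemma reassoc x y z (g : y ~> z) (f : x ~> y) (h : x ~> z) (e : g ∘ f = h)
  t (k : t ~> x) : g ∘ (f ∘ k) = h ∘ k.
Proof. by rewrite compA e. Qed.

Lemma reassoc2 x y y' z (g : y ~> z) (f : x ~> y) (g' : y' ~> z) (f' : x ~> y')
  (e : g ∘ f = g' ∘ f') t (k : t ~> x) : g ∘ (f ∘ k) = g' ∘ (f' ∘ k).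
Proof. by rewrite compA e compA. Qed.

Lemma comp0m x y z (f : x ~> y) : (0 : y ~> z) ∘ f = 0.
Proof. by apply: (addIr ((0 : y ~> z) ∘ f)); rewrite -compDl !add0r. Qed.
Lemma compm0 x y z (g : y ~> z) : g ∘ (0 : x ~> y) = 0.
Proof. by apply: (addIr (g ∘ (0 : x ~> y))); rewrite -compDr !add0r. Qed.
Lemma compNm x y z (g : y ~> z) (f : x ~> y) : (- g) ∘ f = - (g ∘ f).
Proof. by apply: (addIr (g ∘ f)); rewrite -compDl !addNr comp0m. Qed.
Lemma compmN x y z (g : y ~> z) (f : x ~> y) : g ∘ (- f) = - (g ∘ f).
Proof. by apply: (addIr (g ∘ f)); rewrite -compDr !addNr compm0. Qed.

Lemma is_zero_to x y (f : x ~> y) : is_zero y -> f = 0.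
Proof. by move=> z; rewrite -(comp1m f) z comp0m. Qed.
Lemma is_zero_from x y (f : x ~> y) : is_zero x -> f = 0.
Proof. by move=> z; rewrite -(compm1 f) z compm0. Qed.

Definition iso_id x : iso x x := Iso (comp1m (idm x)) (comp1m (idm x)).
Definition iso_inv x y (f : iso x y) : iso y x := Iso (isoVK f) (isoK f).
Lemma iso_comp_l x y z (g : iso y z) (f : iso x y) :
  (inv f ∘ inv g) ∘ (g ∘ f) = idm x.
Proof. by rewrite -compA (reassoc (isoK g)) comp1m isoK. Qed.
Lemma iso_comp_r x y z (g : iso y z) (f : iso x y) :
  (g ∘ f) ∘ (inv f ∘ inv g) = idm z.
Proof. by rewrite -compA (reassoc (isoVK f)) comp1m isoVK. Qed.
Definition iso_comp x y z (g : iso y z) (f : iso x y) : iso x z :=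
  Iso (iso_comp_l g f) (iso_comp_r g f).

Lemma iso_is_iso x y (f : iso x y) : is_iso f.
Proof. by exists (inv f); rewrite isoK isoVK. Qed.

Definition is_iso_iso x y (f : x ~> y) (h : is_iso f) : iso x y :=
  let: exist g e := cid h in Iso (proj1 e) (proj2 e).
Lemma is_iso_isoE x y (f : x ~> y) (h : is_iso f) : is_iso_iso h = f :> (_ ~> _).
Proof. by rewrite /is_iso_iso; case: (cid h). Qed.

Lemma is_iso_comp x y z (g : y ~> z) (f : x ~> y) :
  is_iso g -> is_iso f -> is_iso (g ∘ f).
Proof.
move=> hg hf; rewrite -(is_iso_isoE hg) -(is_iso_isoE hf).
exact: (iso_is_iso (iso_comp _ _)).
Qed.

Lemma is_iso_cancel_r x y z (g : y ~> z) (f : x ~> y) :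
  is_iso f -> is_iso (g ∘ f) -> is_iso g.
Proof.
case=> f' [e1 e2] h; have := is_iso_comp h (g := g ∘ f) (f := f').
rewrite -compA e2 compm1; apply; by exists f.
Qed.

Lemma iso_mono x y z (f : iso y z) (g h : x ~> y) : f ∘ g = f ∘ h -> g = h.
Proof. by move=> e; rewrite -(comp1m g) -(comp1m h) -(isoK f) -!compA e. Qed.
Lemma iso_epi x y z (f : iso x y) (g h : y ~> z) : g ∘ f = h ∘ f -> g = h.
Proof. by move=> e; rewrite -(compm1 g) -(compm1 h) -(isoVK f) !compA e. Qed.

(** The inverse is the preimage of the identity; injectivity makes this right
    inverse a left inverse. *)
Lemma is_iso_yoneda x y (f : x ~> y) :
  (forall z, bijective (fun g : z ~> x => f ∘ g)) -> is_iso f.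
Proof.
move=> bf; have [k k1 k2] := bf y; have e : f ∘ k (idm y) = idm y by rewrite k2.
exists (k (idm y)); split => //; have [k' k1' _] := bf x.
by apply: (can_inj k1'); rewrite compA e comp1m compm1.
Qed.

Lemma precomp_bij x y z (i : iso x y) : bijective (fun h : y ~> z => h ∘ i).
Proof. by exists (fun h => h ∘ inv i) => h; rewrite -compA ?isoK ?isoVK compm1. Qed.

Lemma postcomp_bij x y z (i : iso x y) : bijective (fun h : z ~> x => i ∘ h).
Proof. by exists (fun h => inv i ∘ h) => h; rewrite compA ?isoK ?isoVK comp1m. Qed.

End Cat.

(** * Coproducts and compact objects *)

Section CompactObjects.

Lemma fsum_additive (I : choiceType) (U V : zmodType) (phi : U -> V)
    (phiD : {morph phi : u v / u + v}) (F : I -> U) :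
  finite_set [set i | F i != 0]%classic ->
  phi (\sum_(i \in [set: I]%classic) F i) =
  \sum_(i \in [set: I]%classic) phi (F i).
Proof.
move=> fin; have phi0 : phi 0 = 0.
  by apply: (addrI (phi 0)); rewrite -phiD !addr0.
have sub : ([set i | F i != 0] `<=` [set: I])%classic by [].
have z i : ([set: I] `\` [set i | F i != 0])%classic i -> F i = 0.
  by case=> _ /=; move/negP; rewrite negbK => /eqP.
rewrite -(fsbig_widen _ _ F sub z) -(fsbig_widen _ _ (phi \o F) sub).
  rewrite !fsbig_finite //; elim/big_rec2: _ => //= i u v _ <-.
  by rewrite phiD.
by move=> i /z /= ->.
Qed.

(** Compactness of y only concerns the functor Hom(y, -), so it can be read
    off an isomorphism with Hom(x, R -) as soon as R preserves coproducts.
    All transfers of compactness below are instances: along isomorphisms, left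
    adjoints, full and faithful functors, and tensoring with a rigid object. *)
Lemma compact_transfer (A B : preadditive) (R : functor B A) (x : A) (y : B)
    (tau : forall z, (y ~> z) -> (x ~> R z)) :
  preserves_coproducts R ->
  (forall z, {morph @tau z : u v / u + v}) ->
  (forall z z' (g : z ~> z') (h : y ~> z), tau _ (g ∘ h) = fmap R g ∘ tau _ h) ->
  (forall z, bijective (@tau z)) ->
  compact x -> compact y.
Proof.
move=> RP tauD tauN tauB cx I X c inj hc h.
have tau0 z : tau z 0 = 0 by apply: (addrI (tau z 0)); rewrite -tauD !addr0.
have sumE (g : forall i, y ~> X i) : finite_set [set i | g i != 0]%classic ->
    tau _ (\sum_(i \in [set: I]%classic) (inj i ∘ g i)) =
    \sum_(i \in [set: I]%classic) (fmap R (inj i) ∘ tau _ (g i)).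
  move=> fin; rewrite (fsum_additive (tauD _)).
    by apply: eq_fsbigr => i _; rewrite tauN.
  apply: sub_finite_set fin => i /=; apply: contraNN => /eqP ->.
  by rewrite compm0.
have supp (g : forall i, y ~> X i) :
    [set i | tau _ (g i) != 0]%classic = [set i | g i != 0]%classic.
  apply/seteqP; split=> i /=; apply: contraNN => /eqP e; apply/eqP.
    by rewrite e tau0.
  by apply: (bij_inj (tauB (X i))); rewrite e tau0.
have [g' [[fg' hg'] ug']] := cx I _ _ _ (RP _ _ _ _ hc) (tau _ h).
have [s sK Ks] : exists2 s : forall z, (x ~> R z) -> (y ~> z),
    (forall z, cancel (@tau z) (s z)) & (forall z, cancel (s z) (@tau z)).
  have inverse z : exists s, cancel (@tau z) s /\ cancel s (@tau z).
    by case: (tauB z) => s; exists s.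
  exists (fun z => sval (cid (inverse z))) => z.
    exact: (proj1 (svalP (cid (inverse z)))).
  exact: (proj2 (svalP (cid (inverse z)))).
exists (fun i => s _ (g' i)); split; last first.
  move=> g [fg hg]; apply: functional_extensionality_dep => i.
  rewrite -(sK _ (g i)); congr (s _ _).
  have -> // : g' = fun i => tau _ (g i).
  apply: ug'; split; first by rewrite supp.
  by rewrite hg sumE.
have fin : finite_set [set i | s (X i) (g' i) != 0]%classic.
  rewrite -supp; apply: sub_finite_set fg' => i /=.
  by rewrite Ks.
split=> //; apply: (bij_inj (tauB c)); rewrite sumE // hg'.
by apply: eq_fsbigr => i _; rewrite Ks.
Qed.

Lemma isomorphic_compact (C : preadditive) (x y : C) :
  isomorphic x y -> compact x -> compact y.
Proof.
case=> i; apply: (compact_transfer (R := id_functor C)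
  (tau := fun z (h : y ~> z) => h ∘ i)) => //.
- by move=> z u v; rewrite compDl.
- by move=> z z' g h; rewrite -compA.
- move=> z; exists (fun h : x ~> z => h ∘ inv i) => h;
  by rewrite -compA ?isoK ?isoVK compm1.
Qed.

Lemma full_faithful_compact (A B : preadditive) (R : functor B A) (y : B) :
  preserves_coproducts R -> additive_functor R ->
  (forall z z', bijective (fun u : z ~> z' => fmap R u)) ->
  compact (R y) -> compact y.
Proof.
move=> RP RD RB; apply: (compact_transfer (R := R)
  (tau := fun z (h : y ~> z) => fmap R h)) => //.
- by move=> z u v; rewrite RD.
- by move=> z z' g h; rewrite fmapM.
Qed.

Section Adjoint.
Variables (A B : preadditive) (L : functor A B) (R : functor B A).
Variable adj : adjunction L R.

Lemma right_adjointK x y (h : L x ~> y) :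
  adj_counit adj y ∘ fmap L (fmap R h ∘ adj_unit adj x) = h.
Proof. by rewrite fmapM compA -adj_counitE -compA adj_tri1 compm1. Qed.
Lemma left_adjointK x y (h : x ~> R y) :
  fmap R (adj_counit adj y ∘ fmap L h) ∘ adj_unit adj x = h.
Proof. by rewrite fmapM -compA -adj_unitE compA adj_tri2 comp1m. Qed.

Lemma right_adjoint_bij x y :
  bijective (fun h : L x ~> y => fmap R h ∘ adj_unit adj x).
Proof.
exists (fun h => adj_counit adj y ∘ fmap L h) => h; first exact: right_adjointK.
exact: left_adjointK.
Qed.
Lemma left_adjoint_bij x y :
  bijective (fun h : x ~> R y => adj_counit adj y ∘ fmap L h).
Proof.
exists (fun h => fmap R h ∘ adj_unit adj x) => h; first exact: left_adjointK.
exact: right_adjointK.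
Qed.

(** The transposition sending h to the counit composed with L h is additive
    because L is, and it determines R on morphisms. *)
Lemma right_adjoint_additive : additive_functor L -> additive_functor R.
Proof.
move=> LD y y' u v; apply: (bij_inj (left_adjoint_bij _ _)).
by rewrite /= LD compDr -!adj_counitE compDl.
Qed.

Lemma left_adjoint_preserves_coproducts : preserves_coproducts L.
Proof.
move=> I X c inj hc z g.
have [h [hE hU]] := hc _ (fun i => fmap R (g i) ∘ adj_unit adj (X i)).
exists (adj_counit adj z ∘ fmap L h); split.
  by move=> i; rewrite -compA -fmapM hE right_adjointK.
move=> h' h'E; rewrite -(right_adjointK h'); congr (_ ∘ fmap L _).
by apply: hU => i; rewrite -compA adj_unitE compA -fmapM h'E.
Qed.

(** A left adjoint preserves zero objects and coproducts, hence biproducts,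
    and the sum of f and g is f p + g q precomposed with the diagonal into a
    biproduct.  Applied to tensoring with an object, this derives the
    additivity of tensor products from closedness. *)
Lemma left_adjoint_additive : is_additive_category A -> additive_functor L.
Proof.
case=> [[o zo] bp] x y f g.
have zFo : is_zero (L o).
  by apply: (bij_inj (right_adjoint_bij _ _)); apply: etrans (esym _);
  apply: is_zero_from.
have L0 (u v : A) : fmap L (0 : u ~> v) = 0.
  rewrite -(compm0 u (0 : o ~> v)) fmapM.
  by rewrite (is_zero_from (fmap L _) zFo) comp0m.
have [s [i [j [p [q [pi qj sE]]]]]] := bp x x.
have qi : q ∘ i = 0.
  have: q ∘ (i ∘ p + j ∘ q) = q by rewrite sE compm1.
  rewrite compDr (compA q j) qj comp1m => /eqP; rewrite addrC -subr_eq0.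
  rewrite addrAC subrr add0r => /eqP e.
  by rewrite -(compm1 i) -pi !compA -(compA q i) e !comp0m.
have pj : p ∘ j = 0.
  have: p ∘ (i ∘ p + j ∘ q) = p by rewrite sE compm1.
  rewrite compDr (compA p i) pi comp1m => /eqP; rewrite -subr_eq0.
  rewrite addrAC subrr add0r => /eqP e.
  by rewrite -(compm1 j) -qj !compA -(compA p j) e !comp0m.
(* L s is still generated by the images of the two summands. *)
have ext (z : B) (h k : L s ~> z) :
    h ∘ fmap L i = k ∘ fmap L i -> h ∘ fmap L j = k ∘ fmap L j -> h = k.
  move=> ei ej; apply: (bij_inj (right_adjoint_bij _ _)) => /=.
  rewrite -(compm1 (fmap R h ∘ _)) -(compm1 (fmap R k ∘ _)) -sE !compDr.
  rewrite !compA -!(compA _ (adj_unit adj _)) !adj_unitE.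
  by rewrite !compA -!fmapM ei ej.
have LsE : fmap L i ∘ fmap L p + fmap L j ∘ fmap L q = idm (L s).
  apply: ext; rewrite compDl comp1m -!compA -!fmapM.
    by rewrite pi qi compm0 compm1 L0 addr0.
  by rewrite pj qj compm0 compm1 L0 add0r.
have fgE : f + g = (f ∘ p + g ∘ q) ∘ (i + j).
  rewrite compDr !compDl -!compA pi qi pj qj !compm1 !compm0.
  by rewrite addr0 add0r.
have fpE : (f ∘ p + g ∘ q) ∘ i = f.
  by rewrite compDl -!compA pi qi compm1 compm0 addr0.
have fqE : (f ∘ p + g ∘ q) ∘ j = g.
  by rewrite compDl -!compA pj qj compm1 compm0 add0r.
rewrite fgE; move: fpE fqE; set h := (_ + _) => fpE fqE.
rewrite fmapM -(comp1m (fmap L (i + j))) -LsE compDl compDr.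
rewrite -!compA -!fmapM !compA fpE fqE -!compA !compDr pi pj qi qj.
by rewrite !(compm0, compm1) addr0 add0r.
Qed.

Lemma left_adjoint_preserves_compacts :
  additive_functor L -> preserves_coproducts R -> preserves_compacts L.
Proof.
move=> LD RP x; have RD := right_adjoint_additive LD.
apply: (compact_transfer (R := R)
  (tau := fun z (h : L x ~> z) => fmap R h ∘ adj_unit adj x)) => //.
- by move=> z u v; rewrite RD compDl.
- by move=> z z' g h; rewrite fmapM -compA.
- by move=> z; apply: right_adjoint_bij.
Qed.
End Adjoint.

Section RetractFunctor.
Variables (A B : preadditive) (F : functor A B) (G : functor B A).
Variables (eGF : nat_iso (comp_functor G F) (id_functor A)).

Lemma equivalence_faithful x y : injective (fun u : x ~> y => fmap F u).
Proof.
move=> u v e; apply: (iso_epi (f := eGF x)).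
by rewrite -!(nat_isoE eGF) /= e.
Qed.
End RetractFunctor.

Section Equivalence.
Variables (A B : preadditive) (F : functor A B) (G : functor B A).
Variables (eGF : nat_iso (comp_functor G F) (id_functor A)).
Variables (eFG : nat_iso (comp_functor F G) (id_functor B)).

Lemma equivalence_full x y (v : F x ~> F y) : exists u, fmap F u = v.
Proof.
exists (eGF y ∘ fmap G v ∘ inv (eGF x)).
apply: (equivalence_faithful eFG); apply: (iso_mono (f := eGF y)).
have := nat_isoE eGF (eGF y ∘ fmap G v ∘ inv (eGF x)); rewrite /= => ->.
by rewrite -!compA isoK compm1.
Qed.

Lemma equivalence_bij x y : bijective (fun u : x ~> y => fmap F u).
Proof.
exists (fun v => sval (cid (equivalence_full v))) => u.
  by apply: (equivalence_faithful eGF); rewrite (svalP (cid (equivalence_full _))).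
exact: (svalP (cid (equivalence_full _))).
Qed.

Lemma equivalence_preserves_coproducts : preserves_coproducts F.
Proof.
move=> I X c inj hc z g.
have Ff i := equivalence_full (y := G z) (inv (eFG z) ∘ g i).
have [h [hE hU]] := hc _ (fun i => sval (cid (Ff i))).
have gE i : eFG z ∘ fmap F (sval (cid (Ff i))) = g i.
  by rewrite (svalP (cid (Ff i))) compA isoVK comp1m.
exists (eFG z ∘ fmap F h); split.
  by move=> i; rewrite -compA -fmapM hE gE.
move=> h' h'E; have [k kE] := equivalence_full (y := G z) (inv (eFG z) ∘ h').
have -> : h = k.
  apply: hU => i; apply: (equivalence_faithful eGF).
  by rewrite fmapM kE -compA h'E (svalP (cid (Ff i))).
by rewrite kE compA isoVK comp1m.
Qed.

Lemma equivalence_reflects_compacts :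
  additive_functor F -> forall x, compact (F x) -> compact x.
Proof.
move=> FD x; apply: full_faithful_compact => //.
  exact: equivalence_preserves_coproducts.
by move=> z z'; apply: equivalence_bij.
Qed.

Lemma equivalence_inverse_additive : additive_functor F -> additive_functor G.
Proof.
move=> FD x y u v; apply: (equivalence_faithful eGF).
rewrite FD; apply: (iso_mono (f := eFG y)).
by rewrite compDr !(nat_isoE eFG) /= compDl.
Qed.
End Equivalence.
End CompactObjects.

(** * Compact objects detect isomorphisms *)

Lemma fmap0 (A B : preadditive) (F : functor A B) (x y : A) :
  additive_functor F -> fmap F (0 : x ~> y) = 0.
Proof. by move=> FD; apply: (addrI (fmap F 0)); rewrite -FD !addr0. Qed.

Section Triangles.
Variables (C : preadditive) (t : triangulation C).
Local Notation S := (shift t).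

Lemma shift_inj x y (u v : x ~> y) : fmap S u = fmap S v -> u = v.
Proof. exact: (equivalence_faithful (shiftK t)). Qed.

Lemma dist_comp0 x y z (f : x ~> y) (g : y ~> z) (h : z ~> S x) :
  dist f g h -> g ∘ f = 0.
Proof.
move=> T; have [[o zo] _] := tri_additive t.
have [|w [e _]] := dist_fill (dist_id t x zo) T (u := idm x) (v := f) => //.
by rewrite -e compm0.
Qed.

(** After rotating both triangles, the shift of the wanted lift is the third
    component of a map of triangles out of the rotation of c = c -> 0. *)
Lemma dist_exact x y z (f : x ~> y) (g : y ~> z) (h : z ~> S x) :
  dist f g h -> forall c (k : c ~> y), g ∘ k = 0 -> exists l, k = f ∘ l.
Proof.
move=> T c k gk; have [[o zo] _] := tri_additive t.
have T1 := iffLR (dist_rotate _ _ _) (dist_id t c zo).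
have T2 := iffLR (dist_rotate _ _ _) T.
have [|w [_ e]] := dist_fill T1 T2 (u := k) (v := 0).
  by rewrite comp0m gk.
have [l lE] := equivalence_full (shiftK t) (unshiftK t) w.
exists l; apply: shift_inj; rewrite fmapM lE.
by apply: oppr_inj; rewrite -compNm -e fmap1 compmN compm1.
Qed.

Lemma dist_exact2 x y z (f : x ~> y) (g : y ~> z) (h : z ~> S x) :
  dist f g h -> forall c (k : c ~> z), h ∘ k = 0 -> exists l, k = g ∘ l.
Proof. by move=> /dist_rotate T c k; apply: (dist_exact T). Qed.

(** A section exists because g vanishes.  It is a retraction because f is a
    monomorphism: exactness at the shift of x, where h vanishes. *)
Lemma dist_cone0_iso x y z (f : x ~> y) (g : y ~> z) (h : z ~> S x) :
  dist f g h -> is_zero z -> is_iso f.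
Proof.
move=> T zz; have [s sE] : exists s, idm y = f ∘ s.
  by apply: (dist_exact T); rewrite (is_zero_to g zz) comp0m.
exists s; split=> //; apply: shift_inj.
suff : fmap S (s ∘ f) - fmap S (idm x) = 0 by move/eqP; rewrite subr_eq0 => /eqP.
have T2 := iffLR (dist_rotate _ _ _) T.
have [|l ->] := dist_exact2 T2 (k := fmap S (s ∘ f) - fmap S (idm x)).
  rewrite compNm compDr compmN -!fmapM compA -sE comp1m compm1 subrr.
  by rewrite oppr0.
by rewrite (is_zero_from h zz) comp0m.
Qed.
End Triangles.

Section Detection.
Variables (C : tt_category) (hC : rigidly_compactly_generated C).
Local Notation t := (tt_tri C).

Lemma unshift_additive : additive_functor (unshift t).
Proof.
exact: (equivalence_inverse_additive (shiftK t) (unshiftK t) (@shift_add _ t)).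
Qed.

Lemma shift_compact x : compact x -> compact (shift t x).
Proof.
move=> cx.
apply: (equivalence_reflects_compacts (unshiftK t) (shiftK t) unshift_additive).
exact: (isomorphic_compact (inhabits (iso_inv (shiftK t x)))).
Qed.

Lemma unshift_compact x : compact x -> compact (unshift t x).
Proof.
move=> cx.
apply: (equivalence_reflects_compacts (shiftK t) (unshiftK t) (@shift_add _ t)).
exact: (isomorphic_compact (inhabits (iso_inv (unshiftK t x)))).
Qed.

Lemma compact_detects_zero (z : C) :
  (forall c, compact c -> forall k : c ~> z, k = 0) -> is_zero z.
Proof.
move=> h; have [I [G [cG gG]]] := rcg_generated hC.
apply: gG => i n; split; apply: h.
  by elim: n => //= n; apply: shift_compact.
by elim: n => //= n; apply: unshift_compact.
Qed.

(** For compact c, surjectivity of Hom(c, f) makes Hom(c, y) -> Hom(c, z) zero,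
    and injectivity of Hom(c, S f), which is the hypothesis for the unshift of
    c, makes Hom(c, z) -> Hom(c, S x) zero; so the cone z vanishes. *)
Lemma compact_detects_iso (x y : C) (f : x ~> y) :
  (forall c, compact c -> bijective (fun k : c ~> x => f ∘ k)) -> is_iso f.
Proof.
move=> bf; have [z [g [h T]]] := dist_cone t f.
apply: (dist_cone0_iso T); apply: compact_detects_zero => c cc k.
have hk0 : h ∘ k = 0.
  have T3 := iffLR (dist_rotate _ _ _) (iffLR (dist_rotate _ _ _) T).
  have [l lE] := equivalence_full (shiftK t) (unshiftK t)
                   (x := unshift t c) (h ∘ k ∘ unshiftK t c).
  have fl0 : f ∘ l = 0.
    apply: (shift_inj (t := t)); rewrite fmapM lE fmap0 //; last exact: shift_add.
    rewrite !compA; have := dist_comp0 T3; rewrite compNm => /eqP.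
    by rewrite oppr_eq0 => /eqP ->; rewrite !comp0m.
  have l0 : l = 0.
    by apply: (bij_inj (bf _ (unshift_compact cc))); rewrite /= fl0 compm0.
  apply: (iso_epi (f := unshiftK t c)).
  by rewrite -lE l0 comp0m fmap0 //; apply: shift_add.
have [l ->] := dist_exact2 T hk0.
have [inv_f _ fK] := bf _ cc.
by rewrite -(fK l) compA (dist_comp0 T) comp0m.
Qed.
End Detection.

(** * Dual pairs in a closed symmetric monoidal category *)

Section Monoidal.
Variable C : closed_smc.
Implicit Types x y z w a b : C.
Local Notation "1" := (tunit : C).

Lemma tens_unit_injr x y (f g : x ~> y) : f ⊗m idm 1 = g ⊗m idm 1 -> f = g.
Proof.
by move=> e; apply: (iso_epi (f := runit x)); rewrite -!runitE e.
Qed.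

Lemma assocVE x x' y y' z z' (f : x ~> x') (g : y ~> y') (h : z ~> z') :
  inv (assoc x' y' z') ∘ (f ⊗m (g ⊗m h)) =
  ((f ⊗m g) ⊗m h) ∘ inv (assoc x y z).
Proof.
apply: (iso_mono (f := assoc x' y' z')); apply: (iso_epi (f := assoc x y z)).
by rewrite !compA isoVK comp1m assocE -!compA isoK compm1.
Qed.

(** The pentagon for x, y, 1, 1, with the last unit absorbed. *)
Lemma runit_tens x y : (idm x ⊗m runit y) ∘ assoc x y 1 = runit (x ⊗ y).
Proof.
apply: tens_unit_injr; apply: (iso_mono (f := assoc x y 1)).
rewrite tensm_idr_comp (reassoc2 (assocE _ _ _)) -triangle tensm_idl_comp.
rewrite -!compA (compA (idm x ⊗m assoc _ _ _)) -pentagon.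
by rewrite -(reassoc2 (assocE _ _ _)) tensm1 triangle.
Qed.

Lemma lunit_runit : lunit 1 = runit 1 :> (_ ~> _).
Proof.
apply: tens_unit_injr; rewrite -triangle -lunit_tens; congr (_ ∘ _).
by apply: (iso_mono (f := lunit 1)); rewrite lunitE.
Qed.

Definition braid_iso x y : iso (x ⊗ y) (y ⊗ x) := Iso (braidK x y) (braidK y x).

(** The hexagon for x, 1, 1, after absorbing the middle unit. *)
Lemma lunit_braid x : lunit x ∘ braid x 1 = runit x.
Proof.
apply: tens_unit_injr; apply: (iso_mono (f := braid_iso x 1)) => /=.
rewrite -(triangle x 1) (reassoc2 (braidE _ _)) -lunit_tens.
rewrite -!compA (compA (assoc _ _ _)) hexagon -!compA (reassoc2 (lunitE _)).
by rewrite (reassoc (lunit_tens _ _)) -tensm_idr_comp.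
Qed.

Lemma tens_isoK x x' y y' (f : iso x x') (g : iso y y') :
  (inv f ⊗m inv g) ∘ (f ⊗m g) = idm _.
Proof. by rewrite -tensmM !isoK tensm1. Qed.
Lemma tens_isoVK x x' y y' (f : iso x x') (g : iso y y') :
  (f ⊗m g) ∘ (inv f ⊗m inv g) = idm _.
Proof. by rewrite -tensmM !isoVK tensm1. Qed.
Definition tens_iso x x' y y' (f : iso x x') (g : iso y y') :=
  Iso (tens_isoK f g) (tens_isoVK f g).

(** The handedness is chosen so that tensoring with b on the right is left
    adjoint to tensoring with a on the right; [pair_unit] and [pair_counit] are
    the unit and counit of that adjunction. *)
Record dual_pair a b (e : a ⊗ b ~> 1) (n : 1 ~> b ⊗ a) : Prop := DualPair {
  dual_pairr : runit b ∘ (idm b ⊗m e) ∘ assoc b a b ∘ (n ⊗m idm b) = lunit b;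
  dual_pairl :
    lunit a ∘ (e ⊗m idm a) ∘ inv (assoc a b a) ∘ (idm a ⊗m n) = runit a
}.

Definition pair_counit a b (e : a ⊗ b ~> 1) w : (w ⊗ a) ⊗ b ~> w :=
  runit w ∘ (idm w ⊗m e) ∘ assoc w a b.

Definition pair_unit a b (n : 1 ~> b ⊗ a) z : z ~> (z ⊗ b) ⊗ a :=
  inv (assoc z b a) ∘ (idm z ⊗m n) ∘ inv (runit z).

Lemma pair_counitE a b (e : a ⊗ b ~> 1) w w' (u : w ~> w') :
  pair_counit e w' ∘ ((u ⊗m idm a) ⊗m idm b) = u ∘ pair_counit e w.
Proof.
rewrite /pair_counit -!compA assocE tensm1 (reassoc2 (esym (tensm_swap _ _))).
by rewrite (reassoc2 (runitE _)).
Qed.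

Lemma runitVE x x' (f : x ~> x') :
  inv (runit x') ∘ f = (f ⊗m idm 1) ∘ inv (runit x).
Proof.
apply: (iso_mono (f := runit x')).
by rewrite compA isoVK comp1m (reassoc2 (runitE _)) isoVK compm1.
Qed.

Lemma pair_unitE a b (n : 1 ~> b ⊗ a) z z' (u : z ~> z') :
  pair_unit n z' ∘ u = ((u ⊗m idm b) ⊗m idm a) ∘ pair_unit n z.
Proof.
rewrite /pair_unit -!compA runitVE (reassoc2 (esym (tensm_swap _ _))).
by rewrite -(tensm1 b a) (reassoc2 (assocVE _ _ _)).
Qed.

Section DualPair.
Variables (a b : C) (e : a ⊗ b ~> 1) (n : 1 ~> b ⊗ a).
Hypothesis en : dual_pair e n.

(** The pentagon for z, b, a, b reduces this to the triangle identity of b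
    tensored with z. *)
Lemma pair_tri1 z : pair_counit e (z ⊗ b) ∘ (pair_unit n z ⊗m idm b) = idm _.
Proof.
apply: (iso_epi (f := tens_iso (runit z) (iso_id b))) => /=.
rewrite comp1m -[RHS]triangle -(dual_pairr en).
rewrite /pair_counit /pair_unit -!compA -tensm_idr_comp -!compA isoK compm1.
rewrite !tensm_idl_comp -!compA -(assocE (idm z) n (idm b)).
have -> : (idm z ⊗m assoc b a b) ∘ (assoc z (b ⊗ a) b ∘
      ((idm z ⊗m n) ⊗m idm b)) =
    assoc z b (a ⊗ b) ∘ (assoc (z ⊗ b) a b ∘
      ((inv (assoc z b a) ∘ (idm z ⊗m n)) ⊗m idm b)).
  rewrite tensm_idr_comp (compA (assoc z b _)) pentagon -!compA.
  by rewrite (compA (assoc z b a ⊗m _)) -tensm_idr_comp isoVK tensm1 comp1m.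
rewrite -(reassoc2 (assocE _ _ _)) tensm1 -runit_tens -!compA.
by rewrite !compA.
Qed.

(** Likewise, with the pentagon for w, a, b, a and the triangle identity of a. *)
Lemma pair_tri2 w : (pair_counit e w ⊗m idm a) ∘ pair_unit n (w ⊗ a) = idm _.
Proof.
apply: (iso_epi (f := runit (w ⊗ a))).
rewrite comp1m -[RHS]runit_tens -(dual_pairl en).
rewrite /pair_counit /pair_unit -!compA isoK compm1.
rewrite !tensm_idr_comp !tensm_idl_comp -triangle -!compA.
rewrite (reassoc2 (assocE _ _ _)) -(tensm1 w a) -(assocE (idm w) (idm a) n).
have e1 : assoc w (a ⊗ b) a ∘ ((assoc w a b ⊗m idm a) ∘ inv (assoc (w ⊗ a) b a))
    = (idm w ⊗m inv (assoc a b a)) ∘ assoc w a (b ⊗ a).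
  apply: (iso_mono (f := tens_iso (iso_id w) (assoc a b a))) => /=.
  apply: (iso_epi (f := assoc (w ⊗ a) b a)).
  rewrite -!compA isoK compm1 !compA -pentagon -tensm_idl_comp isoVK tensm1.
  by rewrite comp1m.
by rewrite (compA (idm w ⊗m inv _) (assoc _ _ _)) -e1 -!compA.
Qed.

Lemma pair_bij z w :
  bijective (fun t : z ~> w ⊗ a => pair_counit e w ∘ (t ⊗m idm b)).
Proof.
exists (fun g : z ⊗ b ~> w => (g ⊗m idm a) ∘ pair_unit n z) => [t|g].
  by rewrite tensm_idr_comp -compA -pair_unitE compA pair_tri2 comp1m.
by rewrite tensm_idr_comp compA pair_counitE -compA pair_tri1 compm1.
Qed.
End DualPair.

Lemma curry_iso k b w (h : k ⊗ b ~> w) :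
  (forall z, bijective (fun t : z ~> k => h ∘ (t ⊗m idm b))) -> is_iso (curry h).
Proof.
move=> hB; apply: is_iso_yoneda => z.
have [s sK Ks] := hB z; exists (fun u => s (ev b w ∘ (u ⊗m idm b))) => u.
  by rewrite tensm_idr_comp compA curryK sK.
by apply: ihom_ext; rewrite tensm_idr_comp compA curryK Ks.
Qed.

(** When maps into b are determined by their pairing with a, the triangle
    identity of a implies that of b: paired with a, both sides of the latter
    become e, by interchange of the two copies of e. *)
Lemma dual_pair_of_left a b (e : a ⊗ b ~> 1) (n : 1 ~> b ⊗ a) :
  (forall z, injective (fun u : z ~> b => e ∘ (idm a ⊗m u))) ->
  lunit a ∘ (e ⊗m idm a) ∘ inv (assoc a b a) ∘ (idm a ⊗m n) = runit a ->
  dual_pair e n.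
Proof.
move=> einj nl; split=> //; apply: einj => /=.
apply: (iso_epi (f := assoc a 1 b)).
rewrite -[RHS]compA triangle -nl !tensm_idl_comp !tensm_idr_comp -!compA.
rewrite -(assocE (idm a) n (idm b)).
have e1 : (idm a ⊗m assoc b a b) ∘ assoc a (b ⊗ a) b
   = assoc a b (a ⊗ b) ∘ (assoc (a ⊗ b) a b ∘ (inv (assoc a b a) ⊗m idm b)).
  apply: (iso_epi (f := tens_iso (assoc a b a) (iso_id b))) => /=.
  by rewrite -pentagon -!compA -tensm_idr_comp isoK tensm1 compm1.
rewrite (compA (idm a ⊗m assoc _ _ _)) e1 -!compA.
rewrite -(reassoc2 (assocE _ _ _)) tensm1 (reassoc (runit_tens _ _)).
rewrite -(reassoc2 (runitE _)) (reassoc2 (tensm_swap e e)).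
rewrite -lunit_tens -!compA (reassoc2 (assocE _ _ _)) tensm1.
by rewrite -(reassoc2 (lunitE _)) lunit_runit.
Qed.

Lemma ev_braid_inj x z :
  injective (fun u : z ~> dual x => ev x 1 ∘ braid x (dual x) ∘ (idm x ⊗m u)).
Proof.
move=> u v /=; rewrite -!compA !braidE !compA => e.
by apply: ihom_ext; apply: (iso_epi (f := braid_iso x z)).
Qed.

Lemma dual_tens_to_ihomK x y :
  ev x y ∘ (dual_tens_to_ihom x y ⊗m idm x) =
  lunit y ∘ (ev x tunit ⊗m idm y) ∘ inv (assoc (dual x) x y)
           ∘ (idm (dual x) ⊗m braid y x) ∘ assoc (dual x) y x.
Proof. exact: curryK. Qed.

(** The coevaluation is the preimage of the name of the identity of x under
    hom(x, 1) (x) x = hom(x, x).  Its defining equation, conjugated by braidings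
    with the help of the hexagon, is the triangle identity of x. *)
Lemma rigid_dual_pair x : rigid x ->
  exists n, dual_pair (ev x 1 ∘ braid x (dual x)) n.
Proof.
move=> rx; set r := is_iso_iso (rx x).
exists (inv r ∘ iid x); apply: dual_pair_of_left => [z|]; first exact: ev_braid_inj.
set n : tunit ~> dual x ⊗ x := inv r ∘ iid x.
have E1 : lunit x ∘ (ev x tunit ⊗m idm x) ∘ inv (assoc (dual x) x x)
           ∘ (idm (dual x) ⊗m braid x x) ∘ assoc (dual x) x x ∘ (n ⊗m idm x)
          = lunit x.
  rewrite -dual_tens_to_ihomK -compA -tensm_idr_comp /n compA.
  by rewrite -(is_iso_isoE (rx x)) isoVK comp1m curryK.
rewrite -[RHS]lunit_braid -[in RHS]E1 -!compA -braidE tensm_idr_comp -!compA.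
have hex : (idm (dual x) ⊗m braid x x) ∘ (assoc (dual x) x x ∘ braid x (dual x ⊗ x))
   = assoc (dual x) x x ∘ ((braid x (dual x) ⊗m idm x) ∘ inv (assoc x (dual x) x)).
  apply: (iso_epi (f := assoc x (dual x) x)).
  rewrite -!compA isoK compm1 (compA (assoc _ _ _)) hexagon !compA.
  by rewrite -tensm_idl_comp braidK tensm1 comp1m.
rewrite (compA (assoc _ _ _) (braid _ _)) (reassoc hex).
by rewrite -!compA (reassoc (isoK _)) comp1m.
Qed.

(** Tensoring with x and hom(hom(x, 1), -) are both right adjoint to tensoring
    with hom(x, 1), and the canonical morphism is the comparison. *)
Lemma rigid_tens_to_ihom_dual x w : rigid x -> is_iso (tens_to_ihom_dual x w).
Proof.
move=> /rigid_dual_pair [n pn]; apply: curry_iso => z.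
apply: (eq_bij (bij_comp (pair_bij pn z w) (h := fun t => braid x w ∘ t) _)).
  by exists (fun t => braid w x ∘ t) => t; rewrite compA braidK comp1m.
by move=> t /=; rewrite /pair_counit tensm_idr_comp !compA.
Qed.

(** Under the isomorphism j of 1 with its dual, the canonical morphism becomes
    the transpose of a composite of unitors. *)
Lemma rigid_unit : rigid 1.
Proof.
move=> y; pose j : 1 ~> dual 1 := curry (runit 1).
have ij : is_iso j.
  apply: curry_iso => z; exists (fun t => t ∘ inv (runit z)) => t.
    by rewrite runitE -compA isoVK compm1.
  by rewrite runitE -compA isoK compm1.
have ijy : is_iso (j ⊗m idm y).
  rewrite -(is_iso_isoE ij).
  exact: (iso_is_iso (tens_iso (is_iso_iso ij) (iso_id y))).
apply: (is_iso_cancel_r ijy).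
have -> : dual_tens_to_ihom 1 y ∘ (j ⊗m idm y) = curry (lunit y ∘ runit (1 ⊗ y)).
  apply: ihom_ext; rewrite curryK tensm_idr_comp compA dual_tens_to_ihomK.
  rewrite -!compA assocE tensm1 (reassoc2 (esym (tensm_swap _ _))).
  rewrite -(tensm1 1 y) (reassoc2 (assocVE _ _ _)).
  rewrite (compA (ev _ _ ⊗m _)) -tensm_idr_comp curryK.
  rewrite -triangle -!compA (reassoc (isoVK _)) comp1m.
  by rewrite (compA (idm _ ⊗m lunit y)) -tensm_idl_comp lunit_braid runit_tens.
apply: curry_iso => z.
exists (fun t => inv (lunit y) ∘ t ∘ inv (runit z)) => t.
  by rewrite -!compA (reassoc2 (runitE _)) (reassoc (isoK _)) comp1m isoVK compm1.
by rewrite -!compA runitE -!compA (reassoc (isoVK _)) comp1m isoK compm1.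
Qed.

(** * Functoriality of the internal hom *)

Lemma ihomm_ev x x' y y' (u : x' ~> x) (v : y ~> y') :
  ev x' y' ∘ (ihomm u v ⊗m idm x') = v ∘ ev x y ∘ (idm _ ⊗m u).
Proof. exact: curryK. Qed.

Lemma ihommM x x' x'' y y' y'' (u : x' ~> x) (u' : x'' ~> x') (v : y ~> y')
  (v' : y' ~> y'') : ihomm u' v' ∘ ihomm u v = ihomm (u ∘ u') (v' ∘ v).
Proof.
apply: ihom_ext; rewrite tensm_idr_comp compA !ihomm_ev -!compA tensm_idl_comp.
by rewrite -tensm_swap (compA (ev x' y')) ihomm_ev -!compA.
Qed.

Lemma ihomm1 x y : ihomm (idm x) (idm y) = idm (ihom x y).
Proof. by apply: ihom_ext; rewrite ihomm_ev comp1m. Qed.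

Lemma dual_tens_to_ihomE x x' y y' (u : x' ~> x) (v : y ~> y') :
  dual_tens_to_ihom x' y' ∘ (dualm u ⊗m v) = ihomm u v ∘ dual_tens_to_ihom x y.
Proof.
apply: ihom_ext; rewrite !tensm_idr_comp !compA dual_tens_to_ihomK ihomm_ev.
rewrite -(compA _ (idm _ ⊗m u)) -tensm_swap compA -(compA v) dual_tens_to_ihomK.
rewrite -!compA -(tensm1 (dual x) y) !assocE.
rewrite -(reassoc2 (lunitE v)) !(compA (idm _ ⊗m braid _ _)) -!tensm_idl_comp.
rewrite -tensmM comp1m !braidE -{1}(compm1 (dualm u)) tensmM tensm_idl_comp.
rewrite -!compA !(reassoc2 (assocVE _ _ _)) !(compA (ev _ _ ⊗m _)) -!tensmM ihomm_ev.
by rewrite !comp1m (compA (idm tunit ⊗m v)) -tensmM comp1m compm1.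
Qed.

Lemma curryE x x' b w (u : x' ~> x) (h : x ⊗ b ~> w) :
  curry h ∘ u = curry (h ∘ (u ⊗m idm b)).
Proof. by apply: ihom_ext; rewrite tensm_idr_comp compA !curryK. Qed.

Lemma ihom_tens_to_ihom2K x y w :
  ev x w ∘ ((ev y (ihom x w) ∘ (ihom_tens_to_ihom2 x y w ⊗m idm y)) ⊗m idm x) =
  ev (x ⊗ y) w ∘ (idm (ihom (x ⊗ y) w) ⊗m braid y x)
                  ∘ assoc (ihom (x ⊗ y) w) y x.
Proof. by rewrite !curryK. Qed.

Lemma ihom_tens_to_ihom2E x x' y y' w w' (u : x' ~> x) (v : y' ~> y) (k : w ~> w') :
  ihomm v (ihomm u k) ∘ ihom_tens_to_ihom2 x y w =
  ihom_tens_to_ihom2 x' y' w' ∘ ihomm (u ⊗m v) k.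
Proof.
apply: ihom_ext; apply: ihom_ext.
have -> : ev y' (ihom x' w') ∘
      ((ihomm v (ihomm u k) ∘ ihom_tens_to_ihom2 x y w) ⊗m idm y')
  = ihomm u k ∘ (ev y (ihom x w) ∘ (ihom_tens_to_ihom2 x y w ⊗m idm y)) ∘ (idm _ ⊗m v).
  by rewrite tensm_idr_comp compA ihomm_ev -!compA tensm_swap.
have -> : ev y' (ihom x' w') ∘
      ((ihom_tens_to_ihom2 x' y' w' ∘ ihomm (u ⊗m v) k) ⊗m idm y')
  = (ev y' _ ∘ (ihom_tens_to_ihom2 x' y' w' ⊗m idm y')) ∘ (ihomm (u ⊗m v) k ⊗m idm y').
  by rewrite tensm_idr_comp compA.
rewrite [in RHS]tensm_idr_comp [in RHS]compA ihom_tens_to_ihom2K.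
rewrite -compA tensm_idr_comp compA ihomm_ev tensm_idr_comp.
rewrite -!compA -(reassoc2 (tensm_swap _ _)) (compA (ev x w)) ihom_tens_to_ihom2K.
rewrite -tensmM comp1m compm1 -!compA !assocE tensm1 -(reassoc2 (tensm_swap _ _)).
rewrite (compA (ev (x' ⊗ y') w')) ihomm_ev -!compA.
by rewrite !(compA (idm _ ⊗m _) (idm _ ⊗m _)) -!tensm_idl_comp braidE.
Qed.

Lemma curry_bij x y z : bijective (fun h : x ⊗ y ~> z => curry h).
Proof.
exists (fun g => ev y z ∘ (g ⊗m idm y)) => h; first exact: curryK.
exact: uncurryK.
Qed.

Lemma uncurry_bij x y z :
  bijective (fun g : x ~> ihom y z => ev y z ∘ (g ⊗m idm y)).
Proof.
exists (fun h => curry h) => h; first exact: uncurryK.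
exact: curryK.
Qed.

Lemma ihom_tens_to_ihom2_iso x y w : is_iso (ihom_tens_to_ihom2 x y w).
Proof.
apply: is_iso_yoneda => z.
pose i := iso_comp (tens_iso (iso_id z) (braid_iso y x)) (assoc z y x).
apply: (eq_bij (bij_comp (curry_bij _ _ _) (bij_comp (curry_bij _ _ _)
  (bij_comp (precomp_bij w i) (uncurry_bij z (x ⊗ y) w))))) => g /=.
rewrite !curryE; congr (curry (curry _)).
by rewrite -!compA assocE tensm1 (reassoc2 (tensm_swap _ _)).
Qed.

Lemma tens_to_ihom_dualE x x' w w' (u : x ~> x') (v : w ~> w') :
  ihomm (dualm u) v ∘ tens_to_ihom_dual x w =
  tens_to_ihom_dual x' w' ∘ (u ⊗m v).
Proof.
rewrite /tens_to_ihom_dual; apply: ihom_ext.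
rewrite tensm_idr_comp compA ihomm_ev -compA -tensm_swap -(compA v).
rewrite (compA (ev (dual x) w)) curryK curryE curryK -!compA.
rewrite -tensm_idr_comp braidE tensm_idr_comp (reassoc2 (assocE _ _ _)).
rewrite -(reassoc2 (runitE _)) tensm_swap -(tensm1 w x) (reassoc2 (assocE _ _ _)).
rewrite !(compA (_ ⊗m _) (_ ⊗m _)) -!tensmM !comp1m !compm1 -!compA !braidE.
rewrite (compA (v ⊗m _)) -tensmM compm1 -(compA (ev x tunit)) braidE.
by rewrite (compA (ev x tunit)) ihomm_ev comp1m -!compA.
Qed.
End Monoidal.

(** * Strong monoidal functors and the projection formula *)

Section StrongMonoidal.
Variables (D C : closed_smc) (F : functor D C) (mF : strong_monoidal F).
Local Notation mt := (mon_tens mF).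
Local Notation u := (mon_unit mF).

Lemma mon_runitV x : fmap F (runit x) ∘ mt x tunit = runit (F x) ∘ (idm _ ⊗m inv u).
Proof.
apply: (iso_epi (f := tens_iso (iso_id (F x)) u)) => /=.
by rewrite mon_runit -compA -tensm_idl_comp isoK tensm1 compm1.
Qed.

Lemma mon_lunitV x : fmap F (lunit x) ∘ mt tunit x = lunit (F x) ∘ (inv u ⊗m idm _).
Proof.
apply: (iso_epi (f := tens_iso u (iso_id (F x)))) => /=.
by rewrite mon_lunit -compA -tensm_idr_comp isoK tensm1 compm1.
Qed.

Lemma fmap_isoK (x y : D) (i : iso x y) : fmap F (inv i) ∘ fmap F i = idm _.
Proof. by rewrite -fmapM isoK fmap1. Qed.
Lemma fmap_isoVK (x y : D) (i : iso x y) : fmap F i ∘ fmap F (inv i) = idm _.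
Proof. by rewrite -fmapM isoVK fmap1. Qed.
Definition fmap_iso (x y : D) (i : iso x y) : iso (F x) (F y) :=
  Iso (fmap_isoK i) (fmap_isoVK i).

Variables (a b : D) (e : a ⊗ b ~> tunit) (n : tunit ~> b ⊗ a).

Definition mon_ev : F a ⊗ F b ~> tunit := inv u ∘ fmap F e ∘ mt a b.
Definition mon_coev : tunit ~> F b ⊗ F a := inv (mt b a) ∘ fmap F n ∘ u.

(** Up to the structure isomorphisms, the image of the counit of a dual pair
    is the counit of the image pair. *)
Lemma mon_pair_counit w :
  fmap F (pair_counit e w) ∘ mt (w ⊗ a) b ∘ (mt w a ⊗m idm (F b)) =
  pair_counit mon_ev (F w).
Proof.
rewrite /pair_counit !fmapM -!compA (compA (fmap F (assoc _ _ _))) mon_assoc.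
rewrite /mon_ev !tensm_idl_comp -!compA -(reassoc2 (mon_tensE mF _ _)) fmap1.
by rewrite (compA (fmap F (runit w))) mon_runitV -!compA.
Qed.

(** Strong monoidal functors preserve equations between composites of
    structural morphisms, in particular the triangle identities. *)
Lemma mon_dual_pair : dual_pair e n -> dual_pair mon_ev mon_coev.
Proof.
case=> nr nl; split.
  have := mon_pair_counit b; rewrite /pair_counit => <-.
  rewrite /mon_coev !tensm_idr_comp -!compA (compA (mt b a ⊗m _)).
  rewrite -tensm_idr_comp isoVK tensm1 comp1m -(fmap1 F b).
  rewrite (reassoc2 (mon_tensE mF _ _)) (compA (fmap F _) (fmap F _)) -fmapM.
  by rewrite !compA nr fmap1 mon_lunit.
have e1 := congr1 (fun h => fmap F h ∘ mt a tunit ∘ (idm _ ⊗m u)) nl.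
rewrite mon_runit in e1; rewrite -[RHS]e1 !fmapM -!compA.
rewrite -[in RHS](reassoc2 (mon_tensE mF _ _)) fmap1.
have av : fmap F (inv (assoc a b a)) ∘ mt a (b ⊗ a) =
  mt (a ⊗ b) a ∘ ((mt a b ⊗m idm _) ∘ (inv (assoc (F a) (F b) (F a)) ∘ (idm _ ⊗m inv (mt b a)))).
  apply: (iso_mono (f := fmap_iso (assoc a b a))).
  apply: (iso_epi (f := tens_iso (iso_id (F a)) (mt b a))) => /=.
  rewrite !compA fmap_isoVK comp1m mon_assoc -!compA -tensm_idl_comp isoK tensm1.
  by rewrite compm1 isoVK compm1.
rewrite (compA (fmap F (inv _))) av -!compA -(fmap1 F a) -(reassoc2 (mon_tensE mF _ _)).
rewrite (compA (fmap F (lunit a))) mon_lunitV /mon_ev /mon_coev !fmap1.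
by rewrite !tensm_idl_comp !tensm_idr_comp -!compA.
Qed.
End StrongMonoidal.

Lemma bij_cancel (X Y Z : Type) (phi : X -> Y) (psi : Y -> Z) (chi : X -> Z) :
  bijective psi -> bijective chi -> (forall x, psi (phi x) = chi x) ->
  bijective phi.
Proof.
move=> [p pK Kp] [c cK Kc] e; exists (c \o psi) => x /=; first by rewrite e cK.
by apply: (can_inj pK); rewrite e Kc.
Qed.

Section Projection.
Variables (D C : closed_smc) (F : functor D C) (mF : strong_monoidal F).
Variables (G : functor C D) (adj : adjunction F G).
Local Notation mt := (mon_tens mF).

Definition projection (c : D) (a : C) : c ⊗ G a ~> G (F c ⊗ a) :=
  lax_tens mF adj (F c) a ∘ (adj_unit adj c ⊗m idm (G a)).

Lemma projection_transpose c a :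
  adj_counit adj _ ∘ fmap F (projection c a) =
  (idm (F c) ⊗m adj_counit adj a) ∘ inv (mt c (G a)).
Proof.
rewrite /projection fmapM compA lax_tensK -compA mon_tensVE fmap1 compA -tensmM.
by rewrite adj_tri1 compm1.
Qed.

Lemma mon_braidV x y :
  inv (mt y x) ∘ fmap F (braid x y) = braid (F x) (F y) ∘ inv (mt x y).
Proof.
apply: (iso_mono (f := mt y x)); apply: (iso_epi (f := mt x y)).
by rewrite !compA isoVK comp1m mon_braid -!compA isoK compm1.
Qed.

(** For a rigid c with dual c' there are bijections
      Hom(z, Ga (x) c) = Hom(z (x) c', Ga) = Hom(Fz (x) Fc', a)
                       = Hom(Fz, a (x) Fc) = Hom(z, G(a (x) Fc)),
    whose composite is, up to braidings, composition with the projection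
    morphism. *)
Lemma projection_iso c a : rigid c -> is_iso (projection c a).
Proof.
move=> /rigid_dual_pair [n en]; have Fen := mon_dual_pair mF en.
apply: is_iso_yoneda => z; pose phi (t : z ~> G a ⊗ c) :=
  (adj_counit adj a ⊗m idm (F c)) ∘ inv (mt (G a) c) ∘ fmap F t.
(* phi followed by the transposition along the dual pair (F c, F c') is a
   composite of transpositions, so phi is bijective. *)
have phiB : bijective phi.
  have chiB := bij_comp (bij_comp (precomp_bij a (mt z (dual c)))
    (left_adjoint_bij adj _ a)) (pair_bij en z (G a)).
  apply: (bij_cancel (pair_bij Fen (F z) a) chiB) => t /=.
  rewrite fmapM /phi -compA tensm_idr_comp compA pair_counitE -mon_pair_counit.
  rewrite tensm_idr_comp -!compA (compA (mt _ c ⊗m _)) -tensm_idr_comp isoVK.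
  by rewrite tensm1 comp1m -(fmap1 F (dual c)) mon_tensE.
have psiB := bij_comp (postcomp_bij (F z) (braid_iso (F c) a))
  (left_adjoint_bij adj z (F c ⊗ a)).
have chiB := bij_comp phiB (postcomp_bij z (braid_iso c (G a))).
apply: (bij_cancel psiB chiB) => t /=.
rewrite /phi fmapM [fmap F (braid _ _ ∘ t)]fmapM (compA (adj_counit adj _)).
rewrite projection_transpose.
by rewrite !compA braidE -!compA (compA (inv _)) mon_braidV -!compA.
Qed.

Variables (H : functor D C) (adj' : adjunction G H).

(** Under the adjunctions, composition with the internal form of G -| H becomes
    composition with the projection morphism. *)
Lemma internal_adj_transpose c a d (h : F c ⊗ a ~> H d) :
  ev (G a) d ∘ ((internal_adj mF adj adj' a d ∘
     (fmap G (curry h) ∘ adj_unit adj c)) ⊗m idm (G a)) =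
  (adj_counit adj' d ∘ fmap G h) ∘ projection c a.
Proof.
rewrite tensm_idr_comp compA curryK tensm_idr_comp; right_nest.
rewrite -(fmap1 G a) (compA (lax_tens _ _ _ _)) lax_tensE; right_nest.
by rewrite (compA (fmap G (ev _ _))) -fmapM curryK fmap1 /projection; right_nest.
Qed.

Lemma internal_adj_bij c a d : rigid c ->
  bijective (fun k : c ~> G (ihom a (H d)) => internal_adj mF adj adj' a d ∘ k).
Proof.
move=> rc; set p := is_iso_iso (projection_iso a rc).
have srcB := bij_comp (right_adjoint_bij adj c (ihom a (H d))) (curry_bij (F c) a (H d)).
have tgtB := bij_comp (precomp_bij d p) (left_adjoint_bij adj' (F c ⊗ a) d).
have [s sK Ks] := srcB.
have sB : bijective s := Bijective Ks sK.
apply: (bij_cancel (uncurry_bij c (G a) d) (bij_comp tgtB sB)) => k /=.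
by rewrite -{1}(Ks k) internal_adj_transpose is_iso_isoE.
Qed.

Lemma internal_adjE a a' d (u : a' ~> a) :
  ihomm (fmap G u) (idm d) ∘ internal_adj mF adj adj' a d =
  internal_adj mF adj adj' a' d ∘ fmap G (ihomm u (idm (H d))).
Proof.
apply: ihom_ext; rewrite tensm_idr_comp compA ihomm_ev comp1m -compA.
rewrite -tensm_swap compA curryK curryE curryK; right_nest.
rewrite -!(fmap1 G) !lax_tensE.
by rewrite !(compA (fmap G _) (fmap G _)) -!fmapM ihomm_ev comp1m.
Qed.
End Projection.

(** * The Yoneda lemma *)

Section Yoneda.
Variable A : preadditive.

Record presheaf := Presheaf {
  pel :> A -> Type;
  pact : forall x y, (x ~> y) -> pel y -> pel x
}.

Definition nat_bij (P Q : presheaf) : Prop :=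
  exists phi : forall x, P x -> Q x,
    (forall x, bijective (phi x)) /\
    (forall x y (u : x ~> y) p, phi x (pact u p) = pact u (phi y p)).

Lemma nat_bij_trans Q P R : nat_bij P Q -> nat_bij Q R -> nat_bij P R.
Proof.
move=> [f [fB fN]] [g [gB gN]]; exists (fun x => g x \o f x); split=> [x|x y u p].
  exact: bij_comp.
by rewrite /= fN gN.
Qed.

Lemma nat_bij_sym P Q : nat_bij P Q -> nat_bij Q P.
Proof.
move=> [f [fB fN]]; have inverse x : exists g, cancel (f x) g /\ cancel g (f x).
  by case: (fB x) => g; exists g.
pose g x := sval (cid (inverse x)).
have fK x : cancel (f x) (g x) := proj1 (svalP (cid (inverse x))).
have Kf x : cancel (g x) (f x) := proj2 (svalP (cid (inverse x))).
exists g; split=> [x|x y u p]; first exact: Bijective (Kf x) (fK x).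
by apply: (bij_inj (fB x)); rewrite fN !Kf.
Qed.

Definition hom_to (z : A) : presheaf :=
  Presheaf (fun x y (u : x ~> y) (p : y ~> z) => p ∘ u).

Lemma yoneda_iso (z z' : A) : nat_bij (hom_to z) (hom_to z') -> isomorphic z z'.
Proof.
move=> [f [fB fN]]; have fE x (p : x ~> z) : f x p = f z (idm z) ∘ p.
  by have := fN _ _ p (idm z); rewrite /= comp1m.
have [g [gf fg]] : is_iso (f z (idm z)).
  by apply: is_iso_yoneda => x; apply: (eq_bij (fB x)) => p; rewrite fE.
by exists; exists (f z (idm z)) g.
Qed.
End Yoneda.

Section HomFrom.
Variables (A B : preadditive).

Definition hom_from (L : functor A B) (z : B) : presheaf A :=
  @Presheaf A (fun x => L x ~> z) (fun x y u p => p ∘ fmap L u).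

Lemma hom_from_iso (L L' : functor A B) z :
  nat_iso L L' -> nat_bij (hom_from L' z) (hom_from L z).
Proof.
move=> i; exists (fun x p => p ∘ i x); split=> [x|x y u p] /=.
  exact: (precomp_bij z (i x)).
by rewrite -!compA (nat_isoE i).
Qed.

Lemma hom_from_adjunction (L : functor A B) (R : functor B A) z :
  adjunction L R -> nat_bij (hom_from L z) (hom_to (R z)).
Proof.
move=> adj; exists (fun x p => fmap R p ∘ adj_unit adj x); split=> [x|x y u p].
  exact: right_adjoint_bij.
by rewrite /= fmapM -!compA adj_unitE.
Qed.

Lemma hom_to_iso (z z' : A) : iso z z' -> nat_bij (hom_to z) (hom_to z').
Proof.
move=> i; exists (fun x p => i ∘ p); split=> [x|x y u p] /=; last by rewrite compA.
exact: (postcomp_bij x i).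
Qed.

(** The comparison is the transpose of the other counit, and is characterized
    by commuting with the counits ([mE]). *)
Lemma right_adjoint_unique (L : functor A B) (R R' : functor B A) :
  adjunction L R -> adjunction L R' -> nat_iso R R'.
Proof.
move=> a a'.
pose m (S S' : functor B A) (b : adjunction L S) (b' : adjunction L S') y :=
  fmap S' (adj_counit b y) ∘ adj_unit b' (S y).
have mE S S' (b : adjunction L S) (b' : adjunction L S') y :
  adj_counit b' y ∘ fmap L (m S S' b b' y) = adj_counit b y.
  exact: right_adjointK.
clearbody m; have mK S S' (b : adjunction L S) (b' : adjunction L S') y :
  m S' S b' b y ∘ m S S' b b' y = idm (S y).
  apply: (bij_inj (left_adjoint_bij b _ _)).
  by rewrite /= fmapM compA !mE fmap1 compm1.
exists (fun y => Iso (mK _ _ a a' y) (mK _ _ a' a y)) => y y' f.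
apply: (bij_inj (left_adjoint_bij a' _ _)).
by rewrite /= !fmapM !compA mE -!adj_counitE -compA mE.
Qed.
End HomFrom.

(** * Tensor products and duals of compact objects *)

Lemma restrict_nat_iso (A : preadditive) (P : A -> Prop) (F G : functor A A)
    (HF : forall x, P x -> P (F x)) (HG : forall x, P x -> P (G x)) :
  nat_iso (comp_functor G F) (id_functor A) ->
  inhabited (nat_iso (comp_functor (restrict_functor HG) (restrict_functor HF))
    (id_functor (full_sub P))).
Proof.
move=> i; split; unshelve eapply NatIso.
  move=> x; exact: (@Iso (full_sub P)
    (comp_functor (restrict_functor HG) (restrict_functor HF) x) x
    (i (sval x)) (inv (i (sval x))) (isoK (i (sval x))) (isoVK (i (sval x)))).
move=> x y f; exact: (nat_isoE i).
Qed.

Section RigidlyCompactlyGenerated.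
Variables (C : tt_category) (hC : rigidly_compactly_generated C).
Implicit Types x y z : C.

Lemma ihomm_comp y z z' z'' (g : z' ~> z'') (f : z ~> z') :
  ihomm (idm y) (g ∘ f) = ihomm (idm y) g ∘ ihomm (idm y) f.
Proof. by rewrite ihommM comp1m. Qed.

Definition ihom_functor y : functor C C :=
  @Functor C C (fun z => ihom y z) (fun z z' f => ihomm (idm y) f)
    (fun z => ihomm1 y z) (@ihomm_comp y).

Lemma tensor_hom_adjunction y : adjunction (tensor_right y) (ihom_functor y).
Proof.
unshelve eapply Adjunction.
- move=> x; exact: (curry (idm (x ⊗ y))).
- move=> z; exact: (ev y z).
- move=> x x' u /=; apply: ihom_ext; rewrite !tensm_idr_comp !compA curryK comp1m.
  by rewrite ihomm_ev tensm1 compm1 -compA curryK compm1.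
- by move=> z z' g /=; rewrite ihomm_ev tensm1 compm1.
- by move=> x /=; rewrite curryK.
- move=> z /=; apply: ihom_ext; rewrite tensm_idr_comp compA ihomm_ev tensm1.
  by rewrite compm1 -compA curryK tensm1.
Qed.

Lemma tensor_right_additive y : additive_functor (tensor_right y : functor C C).
Proof.
exact: (left_adjoint_additive (tensor_hom_adjunction y) (tri_additive (tt_tri C))).
Qed.

Lemma tensor_right_coproducts y :
  preserves_coproducts (tensor_right y : functor C C).
Proof. exact: (left_adjoint_preserves_coproducts (tensor_hom_adjunction y)). Qed.

Lemma tensor_left_coproducts y : preserves_coproducts (tensor_left y : functor C C).
Proof.
move=> I X c inj hc z g.
have [h [hE hU]] := @tensor_right_coproducts y _ _ _ _ hc _
  (fun i => g i ∘ braid (X i) y).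
exists (h ∘ braid y c); split=> [i /=|h' h'E].
  by rewrite -compA braidE compA hE -compA braidK compm1.
have -> : h = h' ∘ braid c y; last by rewrite -compA braidK compm1.
by apply: hU => i /=; rewrite -compA braidE compA h'E.
Qed.

Lemma curry_additive x y z : {morph (fun h : x ⊗ y ~> z => curry h) : u v / u + v}.
Proof.
move=> u v; apply: ihom_ext.
have := @tensor_right_additive y _ _ (curry u) (curry v); rewrite /= => ->.
by rewrite compDr !curryK.
Qed.

(** The right adjoint hom(b, -) of tensoring with b preserves coproducts when
    it is given by tensoring with an object a. *)
Lemma compact_tens_of_ihom x a b (i : nat_iso (tensor_left a) (ihom_functor b)) :
  compact x -> compact (x ⊗ b).
Proof.
apply: (compact_transfer (R := tensor_left a)
  (tau := fun z (h : x ⊗ b ~> z) => inv (i z) ∘ curry h)).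
- exact: tensor_left_coproducts.
- by move=> z u v; rewrite curry_additive compDr.
- move=> z z' g h; apply: (iso_mono (f := i z')).
  have e := nat_isoE i g; rewrite /= in e *.
  rewrite [RHS]compA e (reassoc (isoVK _)) comp1m -[RHS]compA (reassoc (isoVK _)) comp1m.
  by apply: ihom_ext; rewrite curryK tensm_idr_comp compA ihomm_ev tensm1 compm1 -compA curryK.
- move=> z; apply: bij_comp (curry_bij _ _ _).
  exact: (postcomp_bij _ (iso_inv (i z))).
Qed.

Lemma compact_unit : compact (tunit : C).
Proof. by apply/(rcg_compact_rigid hC); apply: rigid_unit. Qed.

Lemma compact_tens x y : compact x -> compact y -> compact (x ⊗ y).
Proof.
move=> cx /(rcg_compact_rigid hC) ry.
apply: (compact_tens_of_ihom (a := dual y)) cx.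
exists (fun z => is_iso_iso (ry z)) => z z' f; rewrite !is_iso_isoE /=.
by rewrite -dual_tens_to_ihomE /dualm ihomm1.
Qed.

(** hom(hom(x, 1), -) is tensoring with x, so tensoring with hom(x, 1)
    preserves compactness; apply this to the unit. *)
Lemma compact_dual x : compact x -> compact (dual x).
Proof.
move=> /(rcg_compact_rigid hC) rx.
apply: (isomorphic_compact (inhabits (lunit (dual x)))).
apply: (compact_tens_of_ihom (a := x)) compact_unit.
exists (fun z => is_iso_iso (rigid_tens_to_ihom_dual z rx)) => z z' f.
by rewrite !is_iso_isoE /= -tens_to_ihom_dualE /dualm ihomm1.
Qed.

Lemma compact_ihom x y : compact x -> compact y -> compact (ihom x y).
Proof.
move=> cx cy; have rx := iffLR (rcg_compact_rigid hC x) cx.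
apply: (isomorphic_compact (inhabits (is_iso_iso (rx y)))).
by apply: compact_tens => //; apply: compact_dual.
Qed.

Lemma tensor_right_inverse x y (i : iso (x ⊗ y) tunit) :
  nat_iso (comp_functor (tensor_right y) (tensor_right x)) (id_functor C).
Proof.
exists (fun z => iso_comp (runit z) (iso_comp (tens_iso (iso_id z) i) (assoc z x y))).
move=> z z' f; rewrite /=; right_nest.
by rewrite assocE tensm1 (reassoc2 (esym (tensm_swap _ _))) (reassoc2 (runitE _)); right_nest.
Qed.

(** Tensoring with the inverse is an equivalence and sends x to the compact
    unit. *)
Lemma invertible_compact x : tensor_invertible x -> compact x.
Proof.
move=> [y [i]]; have j := iso_comp i (braid_iso y x).
apply: (equivalence_reflects_compacts (tensor_right_inverse j)
  (tensor_right_inverse i) (@tensor_right_additive y)).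
exact: (isomorphic_compact (inhabits (iso_inv i)) compact_unit).
Qed.

Lemma tensor_equivalence x :
  tensor_invertible x -> exists H : forall z, compact z -> compact (z ⊗ x),
  is_equivalence (restrict_functor (F := tensor_right x) H).
Proof.
move=> ix; have cx := invertible_compact ix; case: ix => y [i].
have j := iso_comp i (braid_iso y x).
have cy : compact y by apply: invertible_compact; exists x.
exists (fun z cz => compact_tens cz cx).
exists (restrict_functor (F := tensor_right y) (fun z cz => compact_tens cz cy)).
by split; apply: restrict_nat_iso; apply: tensor_right_inverse.
Qed.
End RigidlyCompactlyGenerated.

(** * The Serre isomorphism *)

Lemma is_iso_fmap (A B : preadditive) (F : functor A B) (x y : A) (h : x ~> y) :
  is_iso h -> is_iso (fmap F h).
Proof. by case=> k [e1 e2]; exists (fmap F k); rewrite -!fmapM e1 e2 !fmap1. Qed.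

Lemma is_iso_ihomm (C : closed_smc) (x x' y y' : C) (u : x' ~> x) (v : y ~> y') :
  is_iso u -> is_iso v -> is_iso (ihomm u v).
Proof.
case=> u' [e1 e2] [v' [e3 e4]]; exists (ihomm u' v').
by rewrite !ihommM e1 e2 e3 e4 !ihomm1.
Qed.

Lemma lunitVE (E : closed_smc) (x x' : E) (u : x ~> x') :
  inv (lunit x') ∘ u = (idm tunit ⊗m u) ∘ inv (lunit x).
Proof.
apply: (iso_mono (f := lunit x')).
by rewrite compA isoVK comp1m (reassoc2 (lunitE _)) isoVK compm1.
Qed.

Section Serre.
Variables (D C : tt_category).
Variables (hD : rigidly_compactly_generated D) (hC : rigidly_compactly_generated C).
Variables (f : tensor_exact_functor D C).
Variables (fR : functor C D) (adj : adjunction f fR).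
Variables (fRR : functor D C) (adj' : adjunction fR fRR).
Let mf := te_monoidal f.
Local Notation om := (dualizing fRR).

Lemma internal_adj_iso a d : is_iso (internal_adj mf adj adj' a d).
Proof.
apply: (compact_detects_iso hD) => c cc; apply: internal_adj_bij.
exact/(rcg_compact_rigid hD).
Qed.

Definition serre_target (x y : C) :
    uHom adj y (x ⊗ om) ~> fR (ihom y (ihom (dual x) om)) :=
  uHomm adj (idm y) (tens_to_ihom_dual x om).

Definition serre_source (x y : C) :
    fR (ihom (ihom x y) om) ~> fR (ihom y (ihom (dual x) om)) :=
  fmap fR (ihom_tens_to_ihom2 (dual x) y om)
    ∘ fmap fR (ihomm (dual_tens_to_ihom x y) (idm om)).

Lemma serre_target_iso x y : rigid x -> is_iso (serre_target x y).
Proof.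
move=> rx; apply: is_iso_fmap; apply: is_iso_ihomm.
  exact: (iso_is_iso (iso_id y)).
exact: rigid_tens_to_ihom_dual.
Qed.

Lemma serre_source_iso x y : rigid x -> is_iso (serre_source x y).
Proof.
move=> rx; apply: is_iso_comp; apply: is_iso_fmap.
  exact: ihom_tens_to_ihom2_iso.
apply: is_iso_ihomm; first exact: rx.
exact: (iso_is_iso (iso_id _)).
Qed.

Lemma serre_targetE x x' y y' (u : x ~> x') (v : y' ~> y) :
  serre_target x' y' ∘ uHomm adj v (u ⊗m idm om) =
  fmap fR (ihomm v (ihomm (dualm u) (idm om))) ∘ serre_target x y.
Proof.
rewrite /serre_target /uHomm /enrichm -!fmapM !ihommM comp1m compm1.
by rewrite tens_to_ihom_dualE.
Qed.

Lemma serre_sourceE x x' y y' (u : x ~> x') (v : y' ~> y) :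
  serre_source x' y' ∘ fmap fR (ihomm (ihomm u v) (idm om)) =
  fmap fR (ihomm v (ihomm (dualm u) (idm om))) ∘ serre_source x y.
Proof.
rewrite /serre_source -!fmapM; congr (fmap fR _).
rewrite -compA ihommM -dual_tens_to_ihomE -ihommM !compA.
by rewrite -ihom_tens_to_ihom2E.
Qed.

(** The canonical morphism goes through the inverses of the two arrows that
    point the wrong way. *)
Lemma serre_existence (x y : C) : rigid x ->
  exists s : dual (uHom adj x y) ~> uHom adj y (x ⊗ om),
    is_iso s /\ canonical_serre adj adj' s.
Proof.
move=> rx; pose T := is_iso_iso (serre_target_iso y rx).
pose R := is_iso_iso (serre_source_iso y rx).
pose I := is_iso_iso (internal_adj_iso (ihom x y) tunit).
exists (iso_comp (iso_inv T) (iso_comp R (iso_inv I))); split.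
  exact: iso_is_iso.
rewrite /canonical_serre /=.
rewrite -[internal_adj _ _ _ _ _](is_iso_isoE (internal_adj_iso (ihom x y) tunit)).
rewrite -[uHomm _ _ _](is_iso_isoE (serre_target_iso y rx)).
rewrite -/T -/I; right_nest.
by rewrite isoK compm1 (reassoc (isoVK _)) comp1m is_iso_isoE.
Qed.

(** Both sides agree after composing with the invertible morphisms of the
    defining equations of s and s', where naturality of the constituents
    applies. *)
Lemma canonical_serre_natural x x' y y' (u : x ~> x') (v : y' ~> y) s s' :
  rigid x -> rigid x' ->
  canonical_serre adj adj' (x := x) (y := y) s ->
  canonical_serre adj adj' (x := x') (y := y') s' ->
  uHomm adj v (u ⊗m idm om) ∘ s = s' ∘ dualm (uHomm adj u v).
Proof.
move=> rx rx' hs hs'.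
pose I := is_iso_iso (internal_adj_iso (ihom x y) tunit).
apply: (iso_mono (f := is_iso_iso (serre_target_iso y' rx'))).
apply: (iso_epi (f := I)); rewrite /I !is_iso_isoE.
have hs2 : serre_target x y ∘ s ∘ internal_adj mf adj adj' (ihom x y) tunit
  = serre_source x y := hs.
have hs2' : serre_target x' y' ∘ s' ∘ internal_adj mf adj adj' (ihom x' y') tunit
  = serre_source x' y' := hs'.
have e : dualm (uHomm adj u v) ∘ internal_adj mf adj adj' (ihom x y) tunit =
  internal_adj mf adj adj' (ihom x' y') tunit ∘ fmap fR (ihomm (ihomm u v) (idm om)).
  exact: internal_adjE.
right_nest; rewrite (reassoc2 (serre_targetE u v)).
rewrite -compA in hs2; rewrite hs2 -serre_sourceE -hs2'.
by right_nest; rewrite e.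
Qed.

(** * Invertibility of the dualizing object *)

(** f_*(x (x) w) is the dual of f_* hom(x, 1). *)
Lemma serre_dual_iso x : rigid x ->
  is_iso (internal_adj mf adj adj' (dual x) tunit
          ∘ fmap fR (tens_to_ihom_dual x om)).
Proof.
move=> rx; apply: is_iso_comp; first exact: internal_adj_iso.
by apply: is_iso_fmap; apply: rigid_tens_to_ihom_dual.
Qed.

(** For rigid r, points of r are functionals on its dual: this is reflexivity
    r = r (x) 1 = hom(hom(r, 1), 1). *)
Definition dual_point (E : closed_smc) (r : E) (q : tunit ~> r) : dual r ~> tunit :=
  ev (dual r) tunit ∘ ((tens_to_ihom_dual r tunit ∘ inv (runit r) ∘ q) ⊗m idm _)
   ∘ inv (lunit (dual r)).

Lemma dual_point_bij (E : closed_smc) (r : E) : rigid r -> bijective (@dual_point E r).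
Proof.
move=> rr; pose t := iso_comp (is_iso_iso (rigid_tens_to_ihom_dual tunit rr)) (iso_inv (runit r)).
apply: (eq_bij (bij_comp (precomp_bij tunit (iso_inv (lunit (dual r))))
  (bij_comp (uncurry_bij tunit (dual r) tunit) (postcomp_bij tunit t)))) => q /=.
by rewrite is_iso_isoE.
Qed.

Lemma dual_pointE (E : closed_smc) (r r' : E) (k : r ~> r') (q : tunit ~> r) :
  dual_point (k ∘ q) = dual_point q ∘ dualm k.
Proof.
rewrite /dual_point -!compA lunitVE.
rewrite (reassoc2 (runitVE k)) -(reassoc2 (tens_to_ihom_dualE k (idm tunit))).
rewrite tensm_idr_comp -!compA (compA (ev (dual r') tunit)) ihomm_ev comp1m.
by rewrite -!compA -(reassoc2 (tensm_swap _ _)).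
Qed.

(** For compact x:
      Hom(x, hom(w, w)) = Hom(f_*(x (x) w), 1) = Hom(1, f_* hom(x, 1)) = Hom(x, 1),
    where f_* hom(x, 1) is rigid because f_* preserves compact objects. *)
Lemma dualizing_homs_compact : GN_duality fR ->
  nat_bij (@Presheaf (compact_sub C) (fun x => sval x ~> ihom om om) (fun x y u p => p ∘ u))
          (@Presheaf (compact_sub C) (fun x => sval x ~> tunit) (fun x y u p => p ∘ u)).
Proof.
move=> gn; have rC x := iffLR (rcg_compact_rigid hC x).
have rD x := iffLR (rcg_compact_rigid hD x).
pose th (x : compact_sub C) := is_iso_iso (serre_dual_iso (rC _ (svalP x))).
pose P2 := @Presheaf (compact_sub C) (fun x => fR (sval x ⊗ om) ~> tunit)
   (fun x y u p => p ∘ fmap fR (u ⊗m idm om)).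
pose P3 := @Presheaf (compact_sub C) (fun x => tunit ~> fR (dual (sval x)))
   (fun x y u p => fmap fR (dualm u) ∘ p).
apply: (@nat_bij_trans _ P2).
  exists (fun x p => adj_counit adj' tunit ∘ fmap fR (ev om om ∘ (p ⊗m idm om))).
  split=> [x|x y u p] /=.
    exact: (bij_comp (left_adjoint_bij adj' _ tunit) (uncurry_bij (sval x) om om)).
  by rewrite tensm_idr_comp !fmapM; right_nest.
apply: (@nat_bij_trans _ P3).
  apply: nat_bij_sym; exists (fun x p => dual_point p ∘ th x).
  split=> [x|x y u p] /=.
    apply: (bij_comp (precomp_bij tunit (th x)) (dual_point_bij _)).
    by apply: rD; apply: gn; apply: compact_dual => //; apply: (svalP x).
  rewrite dual_pointE -!compA; congr (_ ∘ _); rewrite !is_iso_isoE.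
  rewrite /dualm (reassoc2 (internal_adjE _ _ _ _ _)) -!compA -!fmapM.
  by rewrite tens_to_ihom_dualE.
exists (fun x q => ev (sval x) tunit
  ∘ ((adj_counit adj (dual (sval x)) ∘ fmap f q ∘ mon_unit mf) ⊗m idm _)
  ∘ inv (lunit (sval x))).
split=> [x|x y u p] /=.
  apply: (bij_comp (precomp_bij tunit (iso_inv (lunit (sval x))))).
  apply: (bij_comp (uncurry_bij tunit (sval x) tunit)).
  apply: (bij_comp (precomp_bij (dual (sval x)) (mon_unit mf))).
  exact: left_adjoint_bij.
rewrite fmapM (compA (adj_counit _ _)) -adj_counitE; right_nest.
move: (adj_counit _ _ ∘ _) => q.
rewrite lunitVE tensm_idr_comp -compA (compA (ev (sval x) _)) ihomm_ev comp1m.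
by right_nest; rewrite -(reassoc2 (tensm_swap _ _)).
Qed.

Lemma invertible_of_ihom (w z : C) :
  rigid w -> isomorphic (ihom w z) tunit -> tensor_invertible z.
Proof.
move=> rw [i]; exists (dual w).
by split; apply: (iso_comp i (iso_comp (is_iso_iso (rw z)) (braid_iso z (dual w)))).
Qed.

(** If w is compact then so is hom(w, w), and bijections with compact sources
    identify it with 1. *)
Lemma compact_dualizing_invertible :
  GN_duality fR -> compact om -> tensor_invertible om.
Proof.
move=> gn co; have ro := iffLR (rcg_compact_rigid hC om) co.
apply: (invertible_of_ihom ro).
have [[i i' iK Ki]] := @yoneda_iso (compact_sub C)
  (exist _ (ihom om om) (compact_ihom hC co co))
  (exist _ tunit (compact_unit hC)) (dualizing_homs_compact gn).
by split; apply: (@Iso C _ _ i i').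
Qed.

(** Hom(x, hom(v, w)) = Hom(f_*(v (x) x), 1) = Hom(x, f^* 1) = Hom(x, 1). *)
Lemma tensor_left_wirthmuller_invertible (v : C) (fL : functor C D) :
  tensor_invertible v -> adjunction fL f ->
  nat_iso fL (comp_functor fR (tensor_left v)) -> tensor_invertible om.
Proof.
move=> iw aL i; have rw := iffLR (rcg_compact_rigid hC v) (invertible_compact hC iw).
apply: (invertible_of_ihom rw); apply: yoneda_iso.
apply: nat_bij_trans (nat_bij_trans (hom_from_adjunction tunit aL)
   (hom_to_iso (iso_inv (mon_unit mf)))).
apply: nat_bij_trans (hom_from_iso tunit i).
exists (fun x p => adj_counit adj' tunit ∘ fmap fR (ev v om ∘ (p ⊗m idm v) ∘ braid v x)).
split=> [x|x y u p] /=.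
  apply: (bij_comp (left_adjoint_bij adj' _ tunit)).
  apply: (bij_comp (precomp_bij om (braid_iso v x))).
  exact: uncurry_bij.
by right_nest; rewrite -fmapM; right_nest; rewrite braidE tensm_idr_comp; right_nest.
Qed.

(** F 1 agrees with f^(1) by uniqueness of adjoints.  Its right adjoint G 2 is
    left adjoint to F 2 and hence preserves coproducts, so F 1 preserves compact
    objects. *)
Lemma tower_dualizing_compact : infinite_tower f -> compact om.
Proof.
move=> [F [G [F0 tower]]].
have [_ [a1]] := tower 0; have [[b1] [a2]] := tower (0 + 1).
have [[b2] _] := tower (0 + 1 + 1); rewrite F0 in a1.
have fD : additive_functor (te_functor f) := ex_additive (te_exact f).
have GD := right_adjoint_additive a1 fD.
have FD := right_adjoint_additive b1 GD.
have i := right_adjoint_unique adj a1.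
apply: (isomorphic_compact (x := F (0 + 1) tunit)); last first.
  apply: (left_adjoint_preserves_compacts a2 FD); last exact: (compact_unit hD).
  exact: (left_adjoint_preserves_coproducts b2).
apply: yoneda_iso; apply: nat_bij_trans (hom_from_adjunction tunit adj').
apply: nat_bij_trans (hom_from_iso tunit i).
exact: nat_bij_sym (hom_from_adjunction tunit b1).
Qed.

Lemma wirthmuller_invertible : wirthmuller f fR fRR -> tensor_invertible om.
Proof.
case=> gn [co|//|[w [fL [iw [aL] [i]]]]|tower].
- exact: compact_dualizing_invertible.
- exact: tensor_left_wirthmuller_invertible iw aL i.
- by apply: compact_dualizing_invertible => //; apply: tower_dualizing_compact.
Qed.

End Serre.

Theorem theorem6p9 (D C : tt_category)
  (hD : rigidly_compactly_generated D) (hC : rigidly_compactly_generated C)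
  (f : tensor_exact_functor D C) (hf : preserves_coproducts f)
  (fR : functor C D) (adj : adjunction f fR)
  (fRR : functor D C) (adj' : adjunction fR fRR) :
  exists s : forall (x : compact_sub C) (y : C),
      dual (uHom adj (sval x) y) ~> uHom adj y (sval x ⊗ dualizing fRR),
    (forall (x : compact_sub C) (y : C), is_iso (s x y)) /\
    serre_natural adj (tensor_right (dualizing fRR)) s /\
    (forall (x : compact_sub C) (y : C), canonical_serre adj adj' (s x y)) /\
    (wirthmuller f fR fRR ->
     relative_serre_functor adj (tensor_right (dualizing fRR))
       (fun x y : compact_sub C => s x (sval y))).
Proof.
have rx (x : compact_sub C) := iffLR (rcg_compact_rigid hC _) (svalP x).
pose ex (x : compact_sub C) y := cid (serre_existence hD adj adj' y (rx x)).
pose s x y := sval (ex x y).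
have sI x y : is_iso (s x y) := proj1 (svalP (ex x y)).
have sC x y : canonical_serre adj adj' (s x y) := proj2 (svalP (ex x y)).
have sN : serre_natural adj (tensor_right (dualizing fRR)) s.
  move=> x x' u y y' v; clearbody s.
  exact: (canonical_serre_natural hD u v (rx x) (rx x') (sC x y) (sC x' y')).
exists s; split=> //; split=> //; split=> // wirth.
have [gn _] := wirth.
split=> [|x y|x y|x x' y y' u v].
- exact: (tensor_equivalence hC (wirthmuller_invertible hD hC adj adj' wirth)).
- have cxy : compact (uHom adj (sval x) (sval y)).
    by apply: gn; apply: compact_ihom => //; apply: svalP.
  by split=> //; apply: compact_dual.
- exact: sI.
- exact: sN.
Qed.
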